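(* Let $X$ be a Banach space admitting a norming sequence of functionals $(x_n^* )_{n\ge1}$. Let $(\xi_n)_{n\ge1}$ be independent $X$-valued centered Gaussian random variables with first moments $m_n=\mathbb{E}\|\xi_n\|$ and weak variances $\sigma_n=\sup_{k\ge1}(\mathbb{E}|\langle\xi_n,x_k^*\rangle|^2)^{1/2}$, and let $m=\sup_{n\ge1}m_n$. Then, with universal constants, \[\mathbb{E}\sup_{n\ge1}\|\xi_n\|\eqsim m+\rho_\Theta((\sigma_n)_{n\ge1})\eqsim m+\|(\sigma_n)_{n\ge1}\|_\Theta.\] Moreover, if one of these expressions is finite, then $\xi:=(\xi_n)_{n\ge1}$ is an $\ell^\infty(X)$-valued centered Gaussian random variable (with respect to the norming sequence of functionals $(y_j)_j\mapsto\langle y_i,x_k^*\rangle$, $i,k\ge1$, of $\ell^\infty(X)$).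
   Context: All random variables are defined on a complete probability space $(\Omega,\mathcal{A},\mathbb{P})$. A Banach space $X$ admits a norming sequence of functionals if there are $x_n^*\in X^*$ with $\|x_n^*\|\le1$ and $\|x\|=\sup_n|x_n^*(x)|$ for all $x\in X$. A map $\xi:\Omega\to X$ is a centered Gaussian if $\langle\xi,x^*\rangle$ is a real centered Gaussian random variable for every $x^*\in\operatorname{span}\{x_n^*\}$. $a\eqsim b$ means $C^{-1}b\le a\le Cb$ for a universal constant $C$. Let $\Theta(x)=x^2\exp(-\frac1{2x^2})$ ($\Theta(0)=0$). For a real sequence $a=(a_n)$: $\rho_\Theta(a)=\inf\{\delta>0:\sum_n\Theta(a_n/\delta)\le1\}$ and $\|a\|_\Theta=\inf_{\delta>0}\frac1\delta\big[1+\sum_{n\ge1}\Theta(\delta a_n)\big]$. *)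

(* Defs.v *)
From HB Require Import structures.
From mathcomp Require Import all_boot all_order all_algebra.
From mathcomp Require Import all_classical all_reals all_analysis.
Set Implicit Arguments. Unset Strict Implicit. Unset Printing Implicit Defensive.
Import Order.TTheory GRing.Theory Num.Theory.
Import numFieldNormedType.Exports.
Local Open Scope classical_set_scope.
Local Open Scope ring_scope.

Section Defs.
Context {R : realType}.

Definition Theta (x : R) : R :=
  if x == 0 then 0 else x ^+ 2 * expR (- (x ^+ 2 *+ 2)^-1).

(** rho_Theta(a) = inf { delta > 0 : sum_n Theta(a_n / delta) <= 1 }  (in \bar R,
    = +oo when the set is empty). *)
Definition rhoTheta (a : nat -> R) : \bar R :=
  ereal_inf [set d%:E | d in
    [set d : R | 0 < d /\ (\sum_(n <oo) (Theta (a n / d))%:E <= 1)%E]].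

Definition normTheta (a : nat -> R) : \bar R :=
  ereal_inf [set ((d^-1)%:E * (1 + \sum_(n <oo) (Theta (d * a n))%:E))%E | d in
    [set d : R | 0 < d]].

Definition norming_seq (X : normedModType R) (x : nat -> X -> R) : Prop :=
  [/\ (forall k (a : R) (y z : X), x k (a *: y + z) = a * x k y + x k z),
      (forall k (y : X), `|x k y| <= `|y|)
    & (forall y : X, `|y| = sup (range (fun k => `|x k y|)))].

Context {d : measure_display} {T : measurableType d}.

Definition centered_gaussian_real (P : probability T R) (Y : T -> R) : Prop :=
  measurable_fun setT Y /\
  ((forall B : set R, measurable B -> P (Y @^-1` B) = \d_(0 : R) B) \/
   exists s : R, 0 < s /\
     forall B : set R, measurable B -> P (Y @^-1` B) = normal_prob 0 s B).

(** f : T -> X is a centered Gaussian w.r.t. the norming sequence x: every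
    <f, x^*> with x^* in span{x_k} is a real centered Gaussian. *)
Definition centered_gaussian (X : normedModType R) (P : probability T R)
    (x : nat -> X -> R) (f : T -> X) : Prop :=
  forall (N : nat) (a : nat -> R),
    centered_gaussian_real P (fun w => \sum_(k < N) a k * x k (f w)).

Definition gen_sigma (X : normedModType R) (x : nat -> X -> R) (f : T -> X)
    : set (set T) :=
  <<s [set A | exists k (B : set R), measurable B /\
                 A = (fun w => x k (f w)) @^-1` B] >>.

Definition independent (X : normedModType R) (P : probability T R)
    (x : nat -> X -> R) (xi : nat -> T -> X) : Prop :=
  forall (s : seq nat) (A : nat -> set T), uniq s ->
    (forall i, i \in s -> gen_sigma x (xi i) (A i)) ->
    P (\big[setI/setT]_(i <- s) A i) = (\prod_(i <- s) P (A i))%E.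

End Defs.

(* Main.v *)
(** Concentration.  Let f be the maximum of finitely many centered jointly
    Gaussian variables g_k with standard deviations at most s, and let X, Y be
    independent copies.  If k0 is an argmax at X and k1 an argmax at X + Y, then
    f(X) <= 2 f(Y) + g_k1(X - Y) - g_k0(Y).  Since X + Y and X - Y are
    independent, so are k1 and X - Y; restricting to {f(Y) <= 2 M} with
    M >= E f this bounds E (f - 4 M - 2 L)_+ by 4 L Theta(sqrt 2 s / L), because
    E (G - L)_+ <= L Theta(s / L) for G of law N(0, s^2).

    Upper bound.  Letting f increase to the norm of xi_n, summing over n and
    taking L = 2 D with sum_n Theta(sigma_n / D) <= 1 gives
    E sup_n |xi_n| <= 4 m + 16 D.

    Lower bound.  Choose coordinates g_n of xi_n with standard deviation at
    least sigma_n / 2 and t >= E sup_n |xi_n|.  By Markov and independence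
    prod_n P(|g_n| <= 4 t) >= 3 / 4, so sum_n P(|g_n| > 4 t) <= 1 / 3, and the
    Gaussian lower tail turns this into sum_n Theta(sigma_n / (24 t)) <= 1.

    Independence and equality of laws are deduced from characteristic functions
    without Fourier inversion: a class of bounded functions that is stable under
    linear combinations, bounded pointwise limits and products with
    cos(t V + c) is stable under products with the indicator of {V >= c}. *)

Require Import Defs.
From HB Require Import structures.
From mathcomp Require Import all_boot all_order all_algebra.
From mathcomp Require Import all_classical all_reals all_analysis.
From mathcomp Require Import measurable_realfun ring lra.
Import Order.TTheory GRing.Theory Num.Theory.
Import numFieldNormedType.Exports.
Local Open Scope classical_set_scope.
Local Open Scope ring_scope.

(** * Expectation of bounded measurable functions *)

(** Gaussianity is given only for linear combinations of coordinates, so no joint density or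
    covariance matrix appears: joint laws enter through expectations of cosines, and variances of
    combinations come from the parallelogram identity. The independence of X + Y and X - Y is
    therefore first a factorisation of such expectations, which then has to be carried over to the
    discrete argmax. The values of the argmax partition the space, so no union bound is paid and the
    estimate survives the passage to infinitely many coordinates. The class argument handles bounded
    functions only; excesses are truncated at N and Fatou removes N. In 4 L Theta(sqrt 2 s / L), one
    factor 2 counts the two error terms, the other bounds 1 / P(f(Y) <= 2 M); sqrt 2 comes from X -
    Y, and L = 2 D absorbs it. In the lower bound, 3 / 4 is Markov at level 4 t, 1 / 3 comes from
    prod (1 - p_n) (1 + sum p_n) <= 1, and 24 is 12 doubled since g_n reaches only half of
    sigma_n. *)

Section bounded_expectation.
Context {R : realType} {d : measure_display} {T : measurableType d}.
Implicit Types (P : probability T R) (f g : T -> R).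

(** The bound holds at every point, so the class is stable under products and uniformly bounded
    pointwise limits, and its members are integrable for every probability. *)
Definition bounded_measurable f :=
  measurable_fun setT f /\ exists M : R, forall x, `|f x| <= M.

Definition Ex P f : R := \int[P]_x f x.

Lemma bm_integrable P f : bounded_measurable f -> P.-integrable setT (EFin \o f).
Proof.
move=> [mf [M fM]]; apply: measurable_bounded_integrable => //.
  by have := @probability_setT _ _ _ P; rewrite /= => ->; rewrite ltry.
by exists M; split; [exact: num_real | move=> y My x _; exact: (le_trans (fM x) (ltW My))].
Qed.

Lemma bm_cst c : bounded_measurable (fun=> c).
Proof. by split; [exact: measurable_cst | exists `|c|]. Qed.

Lemma bmD f g : bounded_measurable f -> bounded_measurable g ->
  bounded_measurable (fun x => f x + g x).
Proof.
move=> [mf [M fM]] [mg [N gN]]; split; first exact: measurable_funD.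
by exists (M + N) => x; rewrite (le_trans (ler_normD _ _))// lerD.
Qed.

Lemma bmM f g : bounded_measurable f -> bounded_measurable g ->
  bounded_measurable (fun x => f x * g x).
Proof.
move=> [mf [M fM]] [mg [N gN]]; split; first exact: measurable_funM.
by exists (M * N) => x; rewrite normrM ler_pM.
Qed.

Lemma bmZ c f : bounded_measurable f -> bounded_measurable (fun x => c * f x).
Proof. by move=> bf; apply: bmM => //; exact: bm_cst. Qed.

Lemma bmB f g : bounded_measurable f -> bounded_measurable g ->
  bounded_measurable (fun x => f x - g x).
Proof.
move=> bf bg; have := bmD _ _ bf (bmZ (-1) _ bg).
by congr bounded_measurable; apply/funext => x; rewrite mulN1r.
Qed.

Lemma bm_indic (A : set T) : measurable A -> bounded_measurable (\1_A : T -> R).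
Proof.
move=> mA; split; first exact: measurable_indic.
by exists 1 => x; rewrite indicE ger0_norm ?ler0n// lern1; case: (_ \in _).
Qed.

Lemma bm_sum (I : Type) (r : seq I) (F : I -> T -> R) :
  (forall i, bounded_measurable (F i)) ->
  bounded_measurable (fun x => \sum_(i <- r) F i x).
Proof.
move=> bF; elim: r => [|i r ih].
  by under eq_fun do rewrite big_nil; exact: bm_cst.
by under eq_fun do rewrite big_cons; exact: bmD.
Qed.

Lemma bm_prod (I : Type) (r : seq I) (F : I -> T -> R) :
  (forall i, bounded_measurable (F i)) ->
  bounded_measurable (fun x => \prod_(i <- r) F i x).
Proof.
move=> bF; elim: r => [|i r ih].
  by under eq_fun do rewrite big_nil; exact: bm_cst.
by under eq_fun do rewrite big_cons; exact: bmM.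
Qed.

Lemma bm_cos f : measurable_fun setT f -> bounded_measurable (fun x => cos (f x)).
Proof.
move=> mf; split; last by exists 1 => x; rewrite ler_norml cos_geN1 cos_le1.
apply: (measurableT_comp _ mf); apply: continuous_measurable_fun.
exact: continuous_cos.
Qed.

Lemma bm_sin f : measurable_fun setT f -> bounded_measurable (fun x => sin (f x)).
Proof.
move=> mf; split; last by exists 1 => x; rewrite ler_norml sin_geN1 sin_le1.
apply: (measurableT_comp _ mf); apply: continuous_measurable_fun.
exact: continuous_sin.
Qed.

Lemma EFin_Ex P f : bounded_measurable f ->
  (Ex P f)%:E = (\int[P]_x (f x)%:E)%E.
Proof.
move=> bf; rewrite /Ex /Rintegral fineK//.
exact: (integrable_fin_num measurableT (bm_integrable P f bf)).
Qed.

Lemma Ex_cst P c : Ex P (fun=> c) = c.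
Proof. by rewrite /Ex Rintegral_cst//= probability_setT mulr1. Qed.

Lemma ExD P f g : bounded_measurable f -> bounded_measurable g ->
  Ex P (fun x => f x + g x) = Ex P f + Ex P g.
Proof. by move=> bf bg; apply: RintegralD => //; exact: bm_integrable. Qed.

Lemma ExB P f g : bounded_measurable f -> bounded_measurable g ->
  Ex P (fun x => f x - g x) = Ex P f - Ex P g.
Proof. by move=> bf bg; apply: RintegralB => //; exact: bm_integrable. Qed.

Lemma ExZ P c f : bounded_measurable f -> Ex P (fun x => c * f x) = c * Ex P f.
Proof. by move=> bf; apply: RintegralZl => //; exact: bm_integrable. Qed.

Lemma Ex_sum P (I : Type) (r : seq I) (F : I -> T -> R) :
  (forall i, bounded_measurable (F i)) ->
  Ex P (fun x => \sum_(i <- r) F i x) = \sum_(i <- r) Ex P (F i).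
Proof.
move=> bF; elim: r => [|i r ih].
  by under eq_fun do rewrite big_nil; rewrite Ex_cst big_nil.
under eq_fun do rewrite big_cons; rewrite ExD//; last exact: bm_sum.
by rewrite ih big_cons.
Qed.

Lemma le_Ex P f g : bounded_measurable f -> bounded_measurable g ->
  (forall x, f x <= g x) -> Ex P f <= Ex P g.
Proof. by move=> bf bg fg; apply: le_Rintegral => //; exact: bm_integrable. Qed.

Lemma Ex_indic P (A : set T) : measurable A -> (Ex P (\1_A))%:E = P A.
Proof.
by move=> mA; rewrite EFin_Ex ?integral_indic ?setIT//; exact: bm_indic.
Qed.

Lemma bm_lim (f_ : nat -> T -> R) f (M : R) :
  (forall n, measurable_fun setT (f_ n)) -> (forall n x, `|f_ n x| <= M) ->
  (forall x, f_ ^~ x @ \oo --> f x) -> bounded_measurable f.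
Proof.
move=> mf fM cf; split.
  by apply: (measurable_fun_cvg mf) => x _; exact: cf.
exists M => x; have cn : `|f_ n x| @[n --> \oo] --> `|f x| by apply: cvg_norm; exact: cf.
rewrite -(cvg_lim _ cn)//; apply: limr_le; first by apply/cvg_ex; exists `|f x|.
by near=> n; exact: fM.
Unshelve. all: by end_near. Qed.

Lemma cvg_Ex P (f_ : nat -> T -> R) f (M : R) :
  (forall n, measurable_fun setT (f_ n)) -> (forall n x, `|f_ n x| <= M) ->
  (forall x, f_ ^~ x @ \oo --> f x) -> Ex P (f_ n) @[n --> \oo] --> Ex P f.
Proof.
move=> mf fM cf; have [mlim blim] := bm_lim f_ f M mf fM cf.
have iM : P.-integrable setT (EFin \o (fun=> M)) by apply/bm_integrable/bm_cst.
have [] := @dominated_convergence _ _ _ P _ measurableT (fun n => EFin \o f_ n)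
    (EFin \o f) (EFin \o (fun=> M)).
- by move=> n; exact/measurable_EFinP.
- exact/measurable_EFinP.
- by apply/aeW => x _; apply/fine_cvgP; split; [exact: nearW | exact: cf].
- exact: iM.
- by apply/aeW => x n _; rewrite /= lee_fin.
move=> _ _ /=; rewrite -EFin_Ex// => /fine_cvg; exact.
Qed.

End bounded_expectation.

(** * Expectations over two independent copies *)

Section bounded_fubini.
Context {R : realType} {d : measure_display} {T : measurableType d}.
Variable P : probability T R.

Lemma bm_fst (f : T -> R) : bounded_measurable f ->
  bounded_measurable (fun z : T * T => f z.1).
Proof.
move=> [mf [M fM]]; split; first exact: (measurableT_comp mf measurable_fst).
by exists M => z.
Qed.

Lemma bm_snd (f : T -> R) : bounded_measurable f ->
  bounded_measurable (fun z : T * T => f z.2).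
Proof.
move=> [mf [M fM]]; split; first exact: (measurableT_comp mf measurable_snd).
by exists M => z.
Qed.

Lemma bm_section1 (f : T * T -> R) x : bounded_measurable f ->
  bounded_measurable (fun y => f (x, y)).
Proof.
move=> [mf [M fM]]; split; last by exists M.
exact: (measurableT_comp mf (measurable_pair1 x)).
Qed.

Lemma Ex_prod (f : T * T -> R) : bounded_measurable f ->
  Ex (P \x P)%E f = Ex P (fun x => Ex P (fun y => f (x, y))).
Proof.
move=> bf; congr fine.
have ifm : (P \x P)%E.-integrable setT (EFin \o f).
  by have := bm_integrable (P \x P)%E f bf.
rewrite -(integral12_prod_meas1 ifm); apply: eq_integral => x _.
by rewrite /fubini_F EFin_Ex//; exact: bm_section1.
Qed.

Lemma Ex_prodM (f g : T -> R) : bounded_measurable f -> bounded_measurable g ->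
  Ex (P \x P)%E (fun z => f z.1 * g z.2) = Ex P f * Ex P g.
Proof.
move=> bf bg; rewrite Ex_prod/=; last by apply: bmM; [exact: bm_fst|exact: bm_snd].
under eq_fun do rewrite ExZ//.
by under eq_fun do rewrite mulrC; rewrite ExZ// mulrC.
Qed.

End bounded_fubini.

(** * From trigonometric functions to half-lines *)

(** In [y] this is the indicator of a closed upper half-line; with the random variable in the first
    slot, [step (f w) (2 * M)] is the indicator of {f <= 2 M}. *)
Definition step {R : realType} (c y : R) : R := (c <= y)%R%:R.

Section sign_iteration.
Context {R : realType}.
Implicit Types s x y : R.

Let p s : R := (3 * s - s ^+ 3) / 2.

Let p_opp s : p (- s) = - p s. Proof. by rewrite /p; ring. Qed.

Let iterp_opp n s : iter n p (- s) = - iter n p s.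
Proof. by elim: n => //= n ->; rewrite p_opp. Qed.

Let p_bound s : `|s| <= 1 -> `|p s| <= 1.
Proof.
rewrite !ler_norml => /andP[s1 s2]; rewrite /p.
have h1 : 0 <= (1 - s) ^+ 2 * (2 + s) by rewrite mulr_ge0 ?sqr_ge0//; lra.
have h2 : 0 <= (1 + s) ^+ 2 * (2 - s) by rewrite mulr_ge0 ?sqr_ge0//; lra.
by apply/andP; split; nra.
Qed.

Lemma iter_sign_bound n s : `|s| <= 1 -> `|iter n p s| <= 1.
Proof. by move=> s1; elim: n => //= n; exact: p_bound. Qed.

(** Geometric convergence: 1 - p u is 1 - u times (1 - u)(2 + u) / 2, which is at most 1 - u / 2,
    hence at most 1 - s / 2 because the iterates increase from s. *)
Let iterp_pos n s : 0 < s <= 1 ->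
  s <= iter n p s <= 1 /\ 1 - iter n p s <= (1 - s / 2) ^+ n.
Proof.
move=> /andP[s0 s1]; elim: n => [|n [/andP[h1 h2] h3]].
  by rewrite /= expr0 lexx s1; split => //; lra.
rewrite iterS; set u := iter n p s in h1 h2 h3 *.
have e1 : p u - u = u * (1 - u) * (1 + u) / 2 by rewrite /p; field.
have e2 : 1 - p u = (1 - u) * ((1 - u) * (2 + u) / 2) by rewrite /p; field.
have g1 : 0 <= u * (1 - u) * (1 + u) / 2.
  by rewrite !mulr_ge0// ?invr_ge0//; lra.
have g2 : 0 <= (1 - u) * ((1 - u) * (2 + u) / 2).
  by rewrite !mulr_ge0// ?invr_ge0//; lra.
split; first by apply/andP; split; lra.
rewrite exprSr e2 ler_pM//; first by lra.
  by rewrite !mulr_ge0// ?invr_ge0//; lra.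
nra.
Qed.

(* The cubic s |-> (3 s - s^3) / 2 fixes -1, 0, 1 and maps [-1, 1] into
   itself, and its iterates converge to the sign: this turns the bounded
   continuous function sin into an indicator using only algebra and limits. *)
Lemma cvg_iter_sign s : `|s| <= 1 -> iter n p s @[n --> \oo] --> Num.sg s.
Proof.
have pos (z : R) : 0 < z <= 1 -> iter n p z @[n --> \oo] --> (1 : R).
  move=> /andP[z0 z1].
  have g : (1 - z / 2) ^+ n @[n --> \oo] --> (0 : R).
    by apply: cvg_expr; rewrite ger0_norm; lra.
  apply/cvgrPdist_le => e e0; move/cvgrPdist_le : g => /(_ e e0) g.
  near=> n; have [/andP[h1 h2] h3] := iterp_pos n z (introT andP (conj z0 z1)).
  rewrite ger0_norm ?subr_ge0// (le_trans h3)//.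
  have : `|0 - (1 - z / 2) ^+ n| <= e by near: n.
  by rewrite sub0r normrN ger0_norm// exprn_ge0//; lra.
move=> s1; have [s0|s0|->] := ltgtP s 0.
- rewrite ltr0_sg//.
  have := pos (- s); rewrite oppr_gt0 s0 -(ltr0_norm s0) s1 => /(_ isT)/cvgN.
  apply: cvg_trans; apply: near_eq_cvg; near=> n.
  by rewrite -[LHS]/(- iter n p `|s|) (ltr0_norm s0) iterp_opp opprK.
- by rewrite gtr0_sg//; apply: pos; rewrite s0 -(gtr0_norm s0).
- rewrite sgr0; apply: cvg_near_cst; apply: nearW.
  by elim=> //= n ->; rewrite /p expr0n/= mulr0 subr0 mul0r.
Unshelve. all: by end_near. Qed.

Lemma sg_sin y : `|y| < pi -> Num.sg (sin y) = Num.sg y.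
Proof.
move=> yp; have [y0|y0|->] := ltgtP y 0; last by rewrite sin0.
- rewrite (ltr0_sg y0) -[y]opprK sinN sgrN gtr0_sg//.
  apply: sin_gt0_pi; rewrite oppr_gt0 y0/=.
  by rewrite -(ltr0_norm y0).
- rewrite (gtr0_sg y0) gtr0_sg//; apply: sin_gt0_pi; rewrite y0/=.
  by rewrite -(gtr0_norm y0).
Qed.

(** Once n + 1 > |y| / pi the argument lies in (-pi, pi), where sin has the sign of its argument;
    the periodicity of sin is thus removed in the limit. *)
Lemma cvg_sg_sin y : Num.sg (sin (y / n.+1%:R)) @[n --> \oo] --> Num.sg y.
Proof.
apply: cvg_near_cst; near=> n.
have n0 : 0 < n.+1%:R :> R by rewrite ltr0n.
rewrite sg_sin; first by rewrite sgrM sgrV (gtr0_sg n0) mulr1.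
rewrite normrM normfV (gtr0_norm n0) ltr_pdivrMr//.
have : `|y| / pi < n.+1%:R.
  near: n; apply: (filterS _ (nbhs_infty_gtr (`|y| / pi))) => n /lt_trans; apply.
  by rewrite ltr_nat.
by rewrite ltr_pdivrMr ?pi_gt0// mulrC.
Unshelve. all: by end_near. Qed.

(** The shift by 1 / (n + 1) decides the boundary case: at y = c the unshifted expression would be 1
    / 2 instead of 1. *)
Lemma cvg_sg_indic c y :
  (1 + Num.sg (y - c + n.+1%:R^-1)) / 2 @[n --> \oo] --> step c y.
Proof.
apply: cvg_near_cst; near=> n.
have n0 : 0 < n.+1%:R^-1 :> R by rewrite invr_gt0 ltr0n.
rewrite /step; case: (leP c y) => cy.
  by rewrite gtr0_sg /=; [lra | move: (n.+1%:R^-1) n0 => u n0; lra].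
rewrite ltr0_sg; first by rewrite subrr mul0r.
suff : n.+1%:R^-1 < c - y by move: (n.+1%:R^-1) => u ?; lra.
rewrite invf_plt ?posrE ?ltr0n ?subr_gt0//.
near: n; apply: (filterS _ (nbhs_infty_gtr ((c - y)^-1))) => n /lt_trans; apply.
by rewrite ltr_nat.
Unshelve. all: by end_near. Qed.

Lemma sum_lattice_count n y : 0 <= y ->
  [/\ \sum_(i < n) step i.+1%:R y <= y,
      y <= n%:R -> y - 1 <= \sum_(i < n) step i.+1%:R y
    & n%:R <= y -> \sum_(i < n) step i.+1%:R y = n%:R].
Proof.
move=> y0; elim: n => [|n [h1 h2 h3]].
  by rewrite big_ord0; split => // h; lra.
rewrite big_ord_recr/= -natr1 {2 4 6}/step.
have [yn|ny] := leP (n%:R + 1) y.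
  by rewrite h3 /=; [split=> [|?|_]; lra|lra].
rewrite /= addr0; split=> // _.
have [yn|ny'] := leP y n%:R; first exact: h2.
by rewrite h3; lra.
Qed.

Lemma lattice_approx n y : 0 <= y <= 1 ->
  `|n.+1%:R^-1 * \sum_(i < n.+1) step (i.+1%:R / n.+1%:R) y - y| <= n.+1%:R^-1.
Proof.
move=> /andP[y0 y1]; have n0 : 0 < n.+1%:R :> R by rewrite ltr0n.
have z0 : 0 <= y * n.+1%:R by rewrite mulr_ge0// ltW.
have [h1 h2 _] := sum_lattice_count n.+1 _ z0.
have h3 := h2 (ler_piMl (ltW n0) y1).
under eq_bigr => i _ do rewrite /step ler_pdivrMr//.
rewrite /step in h1 h3; set S := \sum_(i < _) _ in h1 h3 *.
have -> : n.+1%:R^-1 * S - y = n.+1%:R^-1 * (S - y * n.+1%:R).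
  by field; rewrite lt0r_neq0.
rewrite normrM gtr0_norm ?invr_gt0//.
rewrite ler_piMr ?invr_ge0 ?(ltW n0)// ler_norml; apply/andP; split; lra.
Qed.

End sign_iteration.

(** * Classes of functions stable under multiplication by cosines *)

Section trig_class.
Context {R : realType} {T : Type}.
Variable H : (T -> R) -> Prop.

Definition linear_class := forall (a b : R) f g, H f -> H g ->
  H (fun x => a * f x + b * g x).

Definition limit_class := forall (f_ : nat -> T -> R) f (M : R),
  (forall n, H (f_ n)) -> (forall n x, `|f_ n x| <= M) ->
  (forall x, f_ ^~ x @ \oo --> f x) -> H f.

Definition bounded_class := forall f, H f -> exists M : R, forall x, `|f x| <= M.

Hypotheses (Hlin : linear_class) (Hlim : limit_class) (Hbd : bounded_class).

(** [H] need not be stable under products, but its multipliers are: polynomials and bounded limits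
    of multipliers are again multipliers. *)
Let mult (g : T -> R) := forall f, H f -> H (fun x => f x * g x).

Let eqH f g : (forall x, f x = g x) -> H f -> H g.
Proof. by move=> /funext ->. Qed.

Let multlim (g_ : nat -> T -> R) g (M : R) :
  (forall n, mult (g_ n)) -> (forall n x, `|g_ n x| <= M) ->
  (forall x, g_ ^~ x @ \oo --> g x) -> mult g.
Proof.
move=> mg gM cg f Hf; have [B fB] := Hbd f Hf.
apply: (Hlim (fun n x => f x * g_ n x) _ (B * M)) => [n|n x|x].
- exact: mg.
- by rewrite normrM ler_pM.
- by apply: cvgM; [exact: cvg_cst | exact: cg].
Qed.

Let multlin a b g1 g2 : mult g1 -> mult g2 -> mult (fun x => a * g1 x + b * g2 x).
Proof.
move=> m1 m2 f Hf.
apply: eqH (Hlin a b _ _ (m1 _ Hf) (m2 _ Hf)) => x; ring.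
Qed.

Let multM g1 g2 : mult g1 -> mult g2 -> mult (fun x => g1 x * g2 x).
Proof.
move=> m1 m2 f Hf; apply: eqH (m2 _ (m1 _ Hf)) => x; ring.
Qed.

Let mult1 : mult (fun=> 1).
Proof. by move=> f; apply: eqH => x; rewrite mulr1. Qed.

(** A chain of multipliers: sin by a phase shift, the sign of sin by iterating the cubic, the sign
    of V + u by stretching the period, and finally the half-line. *)
Lemma trig_class_halfline (V : T -> R) :
  (forall f (t c : R), H f -> H (fun x => f x * cos (t * V x + c))) ->
  forall f (c : R), H f -> H (fun x => f x * step c (V x)).
Proof.
move=> Hcos f c Hf.
suff : mult (fun x => step c (V x)) by exact.
have msin t u : mult (fun x => sin (t * V x + u)).
  move=> g Hg; apply: eqH (Hcos g t (u - pi / 2) Hg) => x.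
  by rewrite addrA cosBpihalf.
have msg t u : mult (fun x => Num.sg (sin (t * V x + u))).
  apply: (multlim (fun n x => iter n (fun s => (3 * s - s ^+ 3) / 2)
            (sin (t * V x + u))) _ 1) => [n|n x|x].
  - elim: n => [|n ih]; first exact: msin.
    have := multlin (3 / 2) (- 2^-1) _ _ ih (multM _ _ ih (multM _ _ ih ih)).
    move=> m g Hg; apply: eqH (m g Hg) => x.
    by rewrite iterS; congr (_ * _); field.
  - by apply: iter_sign_bound; rewrite ler_norml sin_geN1 sin_le1.
  - by apply: cvg_iter_sign; rewrite ler_norml sin_geN1 sin_le1.
have sg1 (y : R) : `|Num.sg y| <= 1.
  by have [y0|y0|->] := ltgtP y 0; rewrite ?(ltr0_sg y0) ?(gtr0_sg y0) ?sgr0 ?normrN ?normr1 ?normr0.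
have msgV u : mult (fun x => Num.sg (V x + u)).
  apply: (multlim (fun n x => Num.sg (sin ((V x + u) / n.+1%:R))) _ 1) => [n|n x|x].
  - move=> g Hg; apply: eqH (msg n.+1%:R^-1 (u / n.+1%:R) g Hg) => x.
    by rewrite mulrDl (mulrC (V x)).
  - exact: sg1.
  - exact: cvg_sg_sin.
apply: (multlim (fun n x => (1 + Num.sg (V x - c + n.+1%:R^-1)) / 2) _ 1) => [n|n x|x].
- have m := multlin 2^-1 2^-1 _ _ mult1 (msgV (- c + n.+1%:R^-1)).
  move=> g Hg; apply: eqH (m g Hg) => x; congr (_ * _).
  by rewrite -addrA; field.
- rewrite normrM normfV (@ger0_norm _ 2)// ler_pdivrMr// mul1r.
  by rewrite (le_trans (ler_normD _ _))// normr1; have := sg1 (V x - c + n.+1%:R^-1); lra.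
- exact: cvg_sg_indic.
Qed.

(** Layer cake: after an affine change of [Z] into [Y] with values in [0, 1], the averages of the
    indicators of {Y >= i / n} for i = 1, ..., n are within 1 / n of [Y]. *)
Lemma class_of_halfline_indic (Z : T -> R) (B : R) :
  (forall x, `|Z x| <= B) -> (forall c, H (fun x => step c (Z x))) -> H Z.
Proof.
move=> ZB HZ.
pose B' := `|B| + 1; have B0 : 0 < B' by rewrite ltr_wpDl.
pose Y x := (Z x + B') / (2 * B').
have Y01 x : 0 <= Y x <= 1.
  have := le_trans (ZB x) (ler_norm B); rewrite ler_norml => /andP[h1 h2].
  by rewrite /Y divr_ge0 ?ler_pdivrMr//= /B'; lra.
have HY c : H (fun x => step c (Y x)).
  apply: eqH (HZ (c * (2 * B') - B')) => x.
  by rewrite /step /Y ler_pdivlMr ?lerBlDr//; lra.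
have H1 : H (fun=> 1).
  by apply: eqH (HY 0) => x; rewrite /step; have /andP[-> _] := Y01 x.
have Hsum n (F : nat -> T -> R) : (forall i, H (F i)) -> H (fun x => \sum_(i < n) F i x).
  move=> HF; elim: n => [|n ih].
    by apply: eqH (Hlin 0 0 _ _ H1 H1) => x; rewrite big_ord0; ring.
  by apply: eqH (Hlin 1 1 _ _ ih (HF n)) => x; rewrite big_ord_recr/=; ring.
have HHY : H Y.
  apply: (Hlim (fun n x => n.+1%:R^-1 * \sum_(i < n.+1) step (i.+1%:R / n.+1%:R) (Y x)) _ 2).
  - move=> n; have := Hsum n.+1 (fun i x => step (i.+1%:R / n.+1%:R) (Y x)) (fun i => HY _).
    by move=> h; apply: eqH (Hlin n.+1%:R^-1 0 _ _ h h) => x; ring.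
  - move=> n x; have := lattice_approx n _ (Y01 x); rewrite !ler_norml.
    have : n.+1%:R^-1 <= 1 :> R by rewrite invf_le1 ?ltr0n// ler1n.
    have := Y01 x; move: (n.+1%:R^-1 * _) => S; move: (n.+1%:R^-1) => u.
    move=> /andP[? ?] ? /andP[? ?].
    by apply/andP; split; lra.
  - move=> x; apply/cvgrPdist_le => e e0; near=> n.
    rewrite distrC (le_trans (lattice_approx n _ (Y01 x)))//.
    near: n; apply: (filterS _ (nbhs_infty_gtr e^-1)) => n h.
    rewrite invf_ple ?posrE ?ltr0n// (le_trans (ltW h))// ler_nat//.
apply: eqH (Hlin (2 * B') (- B') _ _ HHY H1) => x.
by rewrite /Y; field; rewrite lt0r_neq0.
Unshelve. all: by end_near. Qed.

End trig_class.

(** * Normal densities *)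

Section density.
Context {R : realType} {d : measure_display} {T : measurableType d}.
Variables (mu nu : {measure set T -> \bar R}) (p : T -> R).
Hypotheses (mp : measurable_fun setT p) (p0 : forall x, 0 <= p x).
Hypothesis nuE : forall A, measurable A -> nu A = (\int[mu]_(x in A) (p x)%:E)%E.
Implicit Type f : T -> \bar R.

Import HBNNSimple.

(** On indicators this is [nuE]; simple functions and monotone convergence do the rest. *)
Lemma ge0_integral_density f : measurable_fun setT f -> (forall x, 0 <= f x)%E ->
  (\int[nu]_x f x = \int[mu]_x (f x * (p x)%:E))%E.
Proof.
move=> mf f0.
have mpE : measurable_fun setT (EFin \o p) by exact/measurable_EFinP.
have pE0 x : (0 <= (p x)%:E)%E by rewrite lee_fin.
pose f_ := nnsfun_approx measurableT mf.
have mf_ n : measurable_fun setT (EFin \o f_ n).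
  by apply/measurable_EFinP; exact: measurable_funP.
have nd_ x (k n : nat) : (k <= n)%N -> f_ k x <= f_ n x.
  by move=> kn; exact/lefP/nd_nnsfun_approx.
transitivity (limn (fun n => \int[nu]_x (f_ n x)%:E))%E.
  rewrite -monotone_convergence//.
  - apply: eq_integral => y _; apply/esym/cvg_lim => //.
    by apply: cvg_nnsfun_approx.
  - by move=> n y _; rewrite lee_fin.
  - by move=> y _ k n kn; rewrite lee_fin; exact: nd_.
rewrite [X in limn X](_ : _ =
    (fun n => \int[mu]_x ((f_ n x)%:E * (p x)%:E))%E).
  rewrite -monotone_convergence//; last 3 first.
    - by move=> n; apply: emeasurable_funM => //; exact: mf_.
    - by move=> n x _; rewrite mule_ge0// lee_fin.
    - move=> x _ k n kn; rewrite lee_wpmul2r// lee_fin.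
      exact: nd_.
  apply: eq_integral => x _; apply/cvg_lim => //.
  apply: cvgeZr => //.
  by apply: cvg_nnsfun_approx.
apply/funext => n.
transitivity (\sum_(k \in range (f_ n)) (k%:E * nu (f_ n @^-1` [set k])))%E.
  by rewrite integralT_nnsfun sintegralE; apply: eq_fsbigr.
under [RHS]eq_integral => x _.
  rewrite fimfunE -fsumEFin// ge0_mule_fsuml; last first.
    by move=> r; rewrite EFinM nnfun_muleindic_ge0.
  over.
rewrite ge0_integral_fsum//; last 2 first.
  - move=> r; apply: emeasurable_funM => //.
    by apply/measurable_EFinP/measurable_funM => //; exact/measurable_indic.
  - by move=> r x _; rewrite mule_ge0// EFinM nnfun_muleindic_ge0.
apply: eq_fsbigr => r rn.
have r0 : 0 <= r by move: rn; rewrite inE => -[x _ <-].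
under [RHS]eq_integral do rewrite EFinM -muleA.
rewrite ge0_integralZl_EFin//; last 2 first.
  - by move=> x _; rewrite mule_ge0// lee_fin.
  - apply: emeasurable_funM => //; apply/measurable_EFinP.
    exact/measurable_indic.
congr (_ * _)%E; rewrite nuE// integral_mkcond; apply: eq_integral => x _.
by rewrite epatch_indic muleC.
Qed.

End density.

Section normal_law.
Context {R : realType}.
Local Notation mu := (@lebesgue_measure R).
Implicit Types (m s t x y : R).

Lemma ge0_integral_normal_prob m s (f : R -> \bar R) :
  measurable_fun setT f -> (forall x, 0 <= f x)%E ->
  (\int[normal_prob m s]_x f x = \int[mu]_x (f x * (normal_pdf m s x)%:E))%E.
Proof.
move=> mf f0; apply: (ge0_integral_density _ (normal_prob m s)) => //.
- exact: measurable_normal_pdf.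
- by move=> x; exact: normal_pdf_ge0.
Qed.

Lemma normal_peak_pos s : 0 < s -> normal_peak s = (s * Num.sqrt (pi *+ 2))^-1.
Proof.
move=> s0; rewrite /normal_peak -mulrnAr sqrtrM ?sqr_ge0// sqrtr_sqr.
by rewrite gtr0_norm.
Qed.

Let c2pi_gt0 : 0 < Num.sqrt (pi *+ 2) :> R.
Proof. by rewrite sqrtr_gt0 mulrn_wgt0// pi_gt0. Qed.

Lemma normal_pdf_pos m s x : 0 < s ->
  normal_pdf m s x =
  (s * Num.sqrt (pi *+ 2))^-1 * expR (- (x - m) ^+ 2 / (s ^+ 2 *+ 2)).
Proof.
by move=> s0; rewrite normal_pdfE ?lt0r_neq0// normal_peak_pos.
Qed.

Lemma normal_pdf_shift m s x y : 0 < s ->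
  normal_pdf (m + y) s (x + y) = normal_pdf m s x.
Proof. by move=> s0; rewrite !normal_pdf_pos// opprD addrACA subrr addr0. Qed.

(* completing the square in [(z - y)^2 / s2^2 + y^2 / s1^2] *)
Lemma normal_pdf_convolution s1 s2 y z : 0 < s1 -> 0 < s2 ->
  let s := Num.sqrt (s1 ^+ 2 + s2 ^+ 2) in
  normal_pdf y s2 z * normal_pdf 0 s1 y =
  normal_pdf 0 s z * normal_pdf (z * s1 ^+ 2 / s ^+ 2) (s1 * s2 / s) y.
Proof.
move=> s10 s20 s.
have ss : 0 < s1 ^+ 2 + s2 ^+ 2 by rewrite addr_gt0// exprn_gt0.
have s0 : 0 < s by rewrite sqrtr_gt0.
have s2E : s ^+ 2 = s1 ^+ 2 + s2 ^+ 2 by rewrite sqr_sqrtr// ltW.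
have n1 := lt0r_neq0 s10; have n2 := lt0r_neq0 s20; have n0 := lt0r_neq0 s0.
have nc := lt0r_neq0 c2pi_gt0; have n3 := lt0r_neq0 ss.
rewrite !normal_pdf_pos ?divr_gt0 ?mulr_gt0// mulrACA -expRD.
rewrite [RHS]mulrACA -expRD; congr (_ * expR _).
  by field; rewrite n1 n2 n0 nc.
rewrite !exprMn exprVn s2E; field.
by rewrite n1 n2 n3.
Qed.

Lemma integral_shift (h : R -> R) y : continuous h -> (forall x, 0 <= h x) ->
  (\int[mu]_x (h (x + y))%:E = \int[mu]_x (h x)%:E)%E.
Proof.
move=> ch h0; pose F (x : R^o) : R^o := x + y.
have F'E : F^`()%classic = cst 1.
  apply/funext => x; rewrite /F derive1E deriveD// derive_cst.
  by rewrite derive_id addr0.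
rewrite [RHS](@increasing_ge0_integration_by_substitutionT _ F h)//.
- by apply: eq_integral => x _; rewrite F'E !fctE mulr1.
- by move=> x z xz; rewrite /F ltrD2r.
- by rewrite F'E => ?; exact: cvg_cst.
- by rewrite F'E; exact: is_cvg_cst.
- by rewrite F'E; exact: is_cvg_cst.
- exact: cvg_addrr_Ny.
- exact: cvg_addrr.
Qed.

(** A translation turns the inner integral into one against the density centred at y. After Tonelli,
    completing the square leaves in y a normal density of total mass 1. *)
Lemma integral_normal_convolution s1 s2 (h : R -> R) : 0 < s1 -> 0 < s2 ->
  continuous h -> (forall x, 0 <= h x) ->
  (\int[normal_prob 0 s1]_y \int[normal_prob 0 s2]_x (h (x + y))%:E =
   \int[normal_prob 0 (Num.sqrt (s1 ^+ 2 + s2 ^+ 2))]_x (h x)%:E)%E.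
Proof.
move=> s10 s20 ch h0; set s := Num.sqrt _.
have s0 : 0 < s by rewrite sqrtr_gt0 addr_gt0// exprn_gt0.
have mh : measurable_fun setT h by exact: continuous_measurable_fun.
have inner y : (\int[normal_prob 0 s2]_x (h (x + y))%:E =
    \int[mu]_z (h z * normal_pdf y s2 z)%:E)%E.
  rewrite ge0_integral_normal_prob//; last 2 first.
  - apply/measurable_EFinP; apply: (measurableT_comp mh).
    exact: measurable_funD.
  - by move=> x; rewrite lee_fin.
  rewrite -(integral_shift (fun z => h z * normal_pdf y s2 z) y); last 2 first.
  - move=> z; apply: cvgM; first exact: ch.
    by apply: continuous_normal_pdf; rewrite lt0r_neq0.
  - by move=> x; rewrite mulr_ge0// normal_pdf_ge0.
  apply: eq_integral => x _; rewrite -EFinM; congr (_ * _)%:E.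
  by have := normal_pdf_shift 0 s2 x y s20; rewrite add0r => ->.
under eq_integral do rewrite inner.
have m2 : measurable_fun setT (fun w : R * R => (h w.2 * normal_pdf w.1 s2 w.2)%:E).
  apply/measurable_EFinP/measurable_funM; first exact: measurableT_comp.
  rewrite [X in measurable_fun _ X](_ : _ =
      normal_pdf 0 s2 \o (fun w : R * R => w.2 - w.1)); last first.
    apply/funext => w /=; rewrite -[in LHS](add0r w.1) -[in LHS](subrK w.1 w.2).
    by rewrite normal_pdf_shift.
  apply: measurableT_comp; first exact: measurable_normal_pdf.
  exact: measurable_funB.
have m3 : measurable_fun setT
    (fun w : R * R => (h w.2 * normal_pdf w.1 s2 w.2 * normal_pdf 0 s1 w.1)%:E).
  under eq_fun do rewrite EFinM; apply: emeasurable_funM => //.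
  apply/measurable_EFinP/measurableT_comp => //; exact: measurable_normal_pdf.
have g0 z y : (0 <= (h z * normal_pdf y s2 z)%:E)%E.
  by rewrite lee_fin mulr_ge0// normal_pdf_ge0.
have g1 z y : (0 <= (h z * normal_pdf y s2 z * normal_pdf 0 s1 y)%:E)%E.
  by rewrite EFinM mule_ge0// lee_fin normal_pdf_ge0.
have mF : measurable_fun setT
    (fun y : R => \int[mu]_z (h z * normal_pdf y s2 z)%:E)%E.
  apply: (@measurable_fun_fubini_tonelli_F _ _ _ _ _ mu
    (fun w : R * R => (h w.2 * normal_pdf w.1 s2 w.2)%:E)) => //.
rewrite [LHS]ge0_integral_normal_prob; last 2 first.
- exact: mF.
- by move=> y; apply: integral_ge0.
transitivity (\int[mu]_y \int[mu]_z
    (h z * normal_pdf y s2 z * normal_pdf 0 s1 y)%:E)%E.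
  apply: eq_integral => y _; rewrite -ge0_integralZr//; last 2 first.
  - apply/measurable_EFinP/measurable_funM => //; exact: measurable_normal_pdf.
  - by rewrite lee_fin normal_pdf_ge0.
rewrite (@fubini_tonelli _ _ _ _ _ mu mu (fun w : R * R =>
  (h w.2 * normal_pdf w.1 s2 w.2 * normal_pdf 0 s1 w.1)%:E))//; last first.
rewrite ge0_integral_normal_prob; last 2 first.
- exact/measurable_EFinP.
- by move=> x; rewrite lee_fin.
apply: eq_integral => z _.
under eq_integral => y _.
  rewrite /= -mulrA normal_pdf_convolution// -/s mulrA EFinM.
  over.
rewrite ge0_integralZl_EFin//.
- by rewrite integral_normal_pdf mule1 EFinM.
- by move=> y _; rewrite lee_fin normal_pdf_ge0.
- by apply/measurable_EFinP; exact: measurable_normal_pdf.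
- by rewrite mulr_ge0// normal_pdf_ge0.
Qed.

End normal_law.

(** * The centered Gaussian law as a functional *)

Section gauss_functional.
Context {R : realType}.
Local Notation mu := (@lebesgue_measure R).
Implicit Types (s t x y : R) (h : R -> R).

(* The law N(0, s^2) as a functional, with [s = 0] meaning the Dirac mass at 0;
   [normal_prob 0 0] is something else in the library. *)
Definition gaussE s h : R := if s == 0 then h 0 else Ex (normal_prob 0 s) h.

Lemma gaussE0 h : gaussE 0 h = h 0.
Proof. by rewrite /gaussE eqxx. Qed.

Lemma gaussE_pos s h : 0 < s -> gaussE s h = Ex (normal_prob 0 s) h.
Proof. by move=> s0; rewrite /gaussE gt_eqF. Qed.

Lemma gaussE_lin s a b h1 h2 :
  bounded_measurable h1 -> bounded_measurable h2 ->
  gaussE s (fun x => a * h1 x + b * h2 x) = a * gaussE s h1 + b * gaussE s h2.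
Proof.
move=> b1 b2; rewrite /gaussE; case: eqP => // _.
by rewrite ExD ?ExZ//; exact: bmZ.
Qed.

Lemma EFin_gaussE s h : 0 < s -> bounded_measurable h ->
  (gaussE s h)%:E = (\int[normal_prob 0 s]_x (h x)%:E)%E.
Proof. by move=> s0 bh; rewrite gaussE_pos// EFin_Ex. Qed.

Lemma gaussE_cst s c : gaussE s (fun=> c) = c.
Proof. by rewrite /gaussE; case: eqP => // _; rewrite Ex_cst. Qed.

Lemma gaussE_1D s h : bounded_measurable h ->
  gaussE s (fun x => 1 + h x) = 1 + gaussE s h.
Proof.
move=> bh; have := gaussE_lin s 1 1 _ _ (bm_cst 1) bh.
rewrite gaussE_cst !mul1r => <-.
by congr gaussE; apply/funext => x; rewrite mul1r.
Qed.

Opaque gaussE.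

Let mlin t c : measurable_fun setT (fun x : R => t * x + c).
Proof. by apply: measurable_funD => //; apply: measurable_funM. Qed.

Lemma gaussE_cosD s t c :
  gaussE s (fun x => cos (t * x + c)) =
  cos c * gaussE s (fun x => cos (t * x)) - sin c * gaussE s (fun x => sin (t * x)).
Proof.
have -> : (fun x => cos (t * x + c)) =
    (fun x => cos c * cos (t * x) + (- sin c) * sin (t * x)).
  by apply/funext => x; rewrite cosD; ring.
rewrite gaussE_lin ?mulNr//; [apply: bm_cos | apply: bm_sin];
  exact: measurable_funM.
Qed.

Lemma gaussE_convolution s1 s2 t c : 0 <= s1 -> 0 <= s2 ->
  gaussE s1 (fun y => gaussE s2 (fun x => cos (t * x + (t * y + c)))) =
  gaussE (Num.sqrt (s1 ^+ 2 + s2 ^+ 2)) (fun x => cos (t * x + c)).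
Proof.
rewrite le_eqVlt => /predU1P[<- s20|s10].
  have -> : Num.sqrt (0 ^+ 2 + s2 ^+ 2) = s2.
    by rewrite expr0n/= add0r sqrtr_sqr ger0_norm.
  by rewrite gaussE0 mulr0 add0r.
rewrite le_eqVlt => /predU1P[<-|s20].
  have -> : Num.sqrt (s1 ^+ 2 + 0 ^+ 2) = s1.
    by rewrite expr0n/= addr0 sqrtr_sqr gtr0_norm.
  by under eq_fun do rewrite gaussE0 mulr0 add0r.
have s0 : 0 < Num.sqrt (s1 ^+ 2 + s2 ^+ 2) by rewrite sqrtr_gt0 addr_gt0// exprn_gt0.
have [s sE] : {s | s = Num.sqrt (s1 ^+ 2 + s2 ^+ 2)} by eexists.
rewrite -sE in s0 *.
(* Adding 1 makes the integrand nonnegative, as the Tonelli argument behind the convolution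
   requires; the constant cancels at the end. *)
pose h x := 1 + cos (t * x + c).
have [F FE] : {F | F = fun y => gaussE s2 (fun x => cos (t * x + (t * y + c)))}.
  by eexists.
rewrite -FE.
have h0 x : 0 <= h x by rewrite /h -lerBlDl sub0r cos_geN1.
have ch : continuous h.
  move=> x; apply: cvgD; first exact: cvg_cst.
  apply: continuous_comp; last exact: continuous_cos.
  by apply: cvgD; [apply: cvgM; [exact: cvg_cst|exact: cvg_id]|exact: cvg_cst].
have bF : bounded_measurable F.
  have e y : F y = gaussE s2 (fun x => cos (t * x)) * cos (t * y + c)
      - gaussE s2 (fun x => sin (t * x)) * sin (t * y + c).
    by rewrite FE gaussE_cosD mulrC [X in _ - X]mulrC.
  rewrite (funext e).
  by apply: bmB; apply: bmZ; [exact: bm_cos (mlin _ _)|exact: bm_sin (mlin _ _)].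
have bc a : bounded_measurable (fun x => cos (t * x + a)) by exact: bm_cos (mlin _ _).
have eF y : (\int[normal_prob 0 s2]_x (h (x + y))%:E = (1 + F y)%:E)%E.
  rewrite FE -(gaussE_1D s2 _ (bc _)) (EFin_gaussE s2 _ s20 (bmD _ _ (bm_cst 1) (bc _))).
  by apply: eq_integral => x _; rewrite /h mulrDr addrA.
have k1 : (1 + gaussE s1 F)%:E = (\int[normal_prob 0 s1]_y (1 + F y)%:E)%E.
  rewrite -(gaussE_1D s1 F bF).
  exact: (EFin_gaussE s1 _ s10 (bmD _ _ (bm_cst 1) bF)).
have k2 : (1 + gaussE s (fun x => cos (t * x + c)))%:E =
    (\int[normal_prob 0 s]_x (h x)%:E)%E.
  rewrite -(gaussE_1D s _ (bc c)).
  exact: (EFin_gaussE s _ s0 (bmD _ _ (bm_cst 1) (bc c))).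
have key : (1 + gaussE s1 F)%:E = (1 + gaussE s (fun x => cos (t * x + c)))%:E.
  have k3 := integral_normal_convolution s1 s2 h s10 s20 ch h0.
  rewrite -sE in k3; apply: (etrans k1); apply: (etrans _ (esym k2)).
  by apply: (etrans _ k3); apply: eq_integral => y _; rewrite eF.
exact: addrI (@EFin_inj R _ _ key).
Qed.

(** The Laplace transform of the square of a Gaussian, parametrised by its value q so that no root
    appears: the factor turns the density of N(0, s^2) into q times that of N(0, (q s)^2). *)
Lemma Ex_normal_gauss_factor s q : 0 < s -> 0 < q -> q < 1 ->
  Ex (normal_prob 0 s) (fun x => expR (- ((q ^- 2 - 1) / (s ^+ 2 *+ 2)) * x ^+ 2)) = q.
Proof.
move=> s0 q0 q1; set l := _ / _.
have l0 : 0 <= l.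
  rewrite divr_ge0 ?mulrn_wge0 ?sqr_ge0// subr_ge0 -invr1 lef_pV2 ?posrE ?exprn_gt0//.
  by rewrite expr_le1// ltW.
have bf : bounded_measurable (fun x => expR (- l * x ^+ 2)).
  split; last first.
    exists 1 => x; rewrite ger0_norm ?expR_ge0// -expR0 ler_expR.
    by rewrite mulNr oppr_le0 mulr_ge0// sqr_ge0.
  by apply: measurableT_comp => //; apply: measurable_funM.
apply: EFin_inj; rewrite EFin_Ex// ge0_integral_normal_prob; last 2 first.
- by apply/measurable_EFinP; case: bf.
- by move=> x; rewrite lee_fin expR_ge0.
have ns := lt0r_neq0 s0; have nq := lt0r_neq0 q0.
have nc : Num.sqrt (pi *+ 2) != 0 :> R.
  by rewrite lt0r_neq0// sqrtr_gt0 mulrn_wgt0// pi_gt0.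
transitivity (\int[mu]_x (q%:E * (normal_pdf 0 (q * s) x)%:E))%E.
  apply: eq_integral => x _; rewrite -!EFinM; congr EFin.
  rewrite !normal_pdf_pos ?mulr_gt0// !subr0 mulrCA -expRD.
  rewrite [RHS]mulrA; congr (_ * expR _); last first.
    by rewrite /l; field; rewrite ns nq.
  by field; rewrite nq ns nc.
rewrite ge0_integralZl_EFin//; last 3 first.
- by move=> x _; rewrite lee_fin normal_pdf_ge0.
- by apply/measurable_EFinP; exact: measurable_normal_pdf.
- exact: ltW.
by rewrite integral_normal_pdf mule1.
Qed.

Let frac_bounds (l y : R) : 0 < l -> 0 <= y ->
  y / (1 + l * y) <= l^-1 * (1 - expR (- l * y)) <= y.
Proof.
move=> l0 y0; have ly : 0 <= l * y by rewrite mulr_ge0// ltW.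
apply/andP; split.
  rewrite -[X in X <= _](mulKf (lt0r_neq0 l0)) ler_pM2l ?invr_gt0// mulNr expRN.
  have e1 : 1 + l * y <= expR (l * y) by exact: expR_ge1Dx.
  have : (expR (l * y))^-1 <= (1 + l * y)^-1 by rewrite lef_pV2 ?posrE ?expR_gt0//; lra.
  suff -> : l * (y / (1 + l * y)) = 1 - (1 + l * y)^-1 by lra.
  by field; rewrite lt0r_neq0//; lra.
rewrite -[X in _ <= X](mulKf (lt0r_neq0 l0)) ler_pM2l ?invr_gt0//.
by have := expR_ge1Dx (- l * y); lra.
Qed.

(** The second moment is minus the derivative at 0 of the transform above. The quotients (1 - exp(-
    l x^2)) / l lie below x^2 and tend to it as l tends to 0, with expectation 2 s^2 q^2 / (1 + q);
    Fatou gives one inequality and domination by x^2 the other. *)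
Lemma normal_second_moment s : 0 < s ->
  (\int[normal_prob 0 s]_x (x ^+ 2)%:E = (s ^+ 2)%:E)%E.
Proof.
move=> s0; pose q (n : nat) : R := 1 - n.+1%:R^-1 / 2.
pose l n : R := (q n ^- 2 - 1) / (s ^+ 2 *+ 2).
have q01 n : 0 < q n /\ q n < 1.
  have h1 : 0 < n.+1%:R^-1 :> R by rewrite invr_gt0 ltr0n.
  have h2 : n.+1%:R^-1 <= 1 :> R by rewrite invf_le1 ?ltr0n// ler1n.
  by rewrite /q; move: (n.+1%:R^-1) h1 h2 => u h1 h2; split; lra.
have l0 n : 0 < l n.
  have [q0 q1] := q01 n.
  rewrite divr_gt0 ?mulrn_wgt0 ?exprn_gt0// subr_gt0 -invr1 ltf_pV2 ?posrE ?exprn_gt0//.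
  by rewrite expr_lt1// ltW.
pose f n x : R := (l n)^-1 * (1 - expR (- l n * x ^+ 2)).
have cq : q n @[n --> \oo] --> (1 : R).
  rewrite -[X in _ --> X](subr0 1); apply: cvgB; first exact: cvg_cst.
  rewrite -[X in _ --> X](mul0r 2^-1); apply: cvgMl; exact: cvg_harmonic.
have cq2 : q n ^+ 2 @[n --> \oo] --> (1 : R).
  by rewrite -[X in _ --> X](mulr1 1); exact: cvgM.
have cl : l n @[n --> \oo] --> (0 : R).
  rewrite -[X in _ --> X](mul0r (s ^+ 2 *+ 2)^-1); apply: cvgMl.
  rewrite -[X in _ --> X](subrr 1); apply: cvgB; last exact: cvg_cst.
  rewrite -[X in _ --> X]invr1; by apply: cvgV.
have mf n : measurable_fun setT (f n).
  apply: measurable_funM => //; apply: measurable_funB => //.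
  by apply: measurableT_comp => //; apply: measurable_funM.
have fb n x : 0 <= f n x <= x ^+ 2.
  have /andP[h1 h2] := frac_bounds (l n) (x ^+ 2) (l0 n) (sqr_ge0 x).
  rewrite /f h2 andbT (le_trans _ h1)// divr_ge0 ?sqr_ge0//.
  by rewrite addr_ge0// mulr_ge0 ?sqr_ge0// ltW.
have bf n : bounded_measurable (f n).
  split => //; exists (l n)^-1 => x; have /andP[h _] := fb n x.
  rewrite ger0_norm// /f ler_piMr ?invr_ge0 ?(ltW (l0 n))//.
have Ef n : Ex (normal_prob 0 s) (f n) = s ^+ 2 *+ 2 * q n ^+ 2 / (1 + q n).
  have [q0 q1] := q01 n.
  have be : bounded_measurable (fun x => expR (- l n * x ^+ 2)).
    have -> : (fun x => expR (- l n * x ^+ 2)) = (fun x => 1 - l n * f n x).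
      by apply/funext => x; rewrite /f mulVKf ?lt0r_neq0//; ring.
    by apply: bmB; [exact: bm_cst | exact: bmZ].
  rewrite /f ExZ; last by apply: bmB; [exact: bm_cst | exact: be].
  rewrite ExB//; last exact: bm_cst.
  rewrite Ex_cst Ex_normal_gauss_factor// /l.
  have ? := lt0r_neq0 s0; have ? := lt0r_neq0 q0.
  have ? : 1 + q n != 0 by rewrite lt0r_neq0//; lra.
  have ? : 1 - q n != 0 by rewrite lt0r_neq0//; lra.
  have n2 : q n ^+ 2 != 0 by rewrite expf_neq0.
  have -> : q n ^- 2 - 1 = (1 - q n) * (1 + q n) / q n ^+ 2 by field.
  by field; apply/and4P.
have cE : Ex (normal_prob 0 s) (f n) @[n --> \oo] --> s ^+ 2.
  apply: (@cvg_trans _ ((fun n => s ^+ 2 *+ 2 * q n ^+ 2 / (1 + q n)) @ \oo)).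
    by apply: near_eq_cvg; apply: nearW => n; rewrite Ef.
  have c1 : s ^+ 2 *+ 2 * q n ^+ 2 / (1 + q n) @[n --> \oo] -->
      (s ^+ 2 *+ 2 * 1 / (1 + 1) : R).
    apply: cvgM; first by apply: cvgM; [exact: cvg_cst | exact: cq2].
    by apply: cvgV; [lra|apply: cvgD => //; exact: cvg_cst].
  have e : s ^+ 2 *+ 2 * 1 / (1 + 1) = s ^+ 2 by field.
  by rewrite e in c1; exact: c1.
have cEE : (\int[normal_prob 0 s]_x (f n x)%:E)%E @[n --> \oo] --> (s ^+ 2)%:E.
  apply/fine_cvgP; split; last exact: cE.
  by apply: nearW => n; rewrite -(EFin_Ex (normal_prob 0 s) (f n) (bf n)).
have mx2 : measurable_fun setT (fun x : R => (x ^+ 2)%:E).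
  by apply/measurable_EFinP; exact: measurable_funX.
apply/eqP; rewrite eq_le; apply/andP; split.
  have mfE n : measurable_fun setT (EFin \o f n) by apply/measurable_EFinP; exact: mf.
  have fE0 n x : setT x -> (0 <= (f n x)%:E)%E.
    by rewrite lee_fin; have /andP[] := fb n x.
  have fat := @fatou _ _ _ (normal_prob 0 s) setT measurableT
    (fun n => EFin \o f n) mfE fE0.
  rewrite (cvg_limn_einf_sup cEE).1 in fat; apply: le_trans fat.
  rewrite le_eqVlt; apply/orP; left; apply/eqP; apply: eq_integral => x _.
  suff cx : (f n x)%:E @[n --> \oo] --> (x ^+ 2)%:E by rewrite (cvg_limn_einf_sup cx).1.
  apply: cvg_EFin; first exact: nearW.
  have g : x ^+ 2 / (1 + l n * x ^+ 2) @[n --> \oo] --> (x ^+ 2 : R).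
    rewrite -[X in _ --> X]mulr1; apply: cvgM; first exact: cvg_cst.
    rewrite -[X in _ --> X]invr1; apply: cvgV => //.
    rewrite -[X in _ --> X]addr0; apply: cvgD; first exact: cvg_cst.
    by rewrite -[X in _ --> X](mul0r (x ^+ 2)); apply: cvgMl.
  have gc : (fun=> x ^+ 2) @ \oo --> (x ^+ 2 : R) by exact: cvg_cst.
  apply: squeeze_cvgr g gc; apply: nearW => n.
  exact: (frac_bounds (l n) _ (l0 n) (sqr_ge0 x)).
rewrite -(cvg_lim _ cEE)//; apply: lime_le.
  by apply/cvg_ex; exists (s ^+ 2)%:E.
apply: nearW => n; apply: ge0_le_integral => //.
- by move=> x _; rewrite lee_fin; have /andP[] := fb n x.
- by apply/measurable_EFinP; exact: mf.
- by move=> x _; rewrite lee_fin; have /andP[] := fb n x.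
Qed.

(* On [x >= L] one has [x^2 = L^2 + 2 L (x - L) + (x - L)^2], so the density
   at x is dominated by that of N(L, s^2). *)
Lemma normal_excess s L : 0 < s -> 0 < L ->
  (\int[normal_prob 0 s]_x (Num.max (x - L) 0)%:E <= (L * Theta (s / L))%:E)%E.
Proof.
move=> s0 L0; have ns := lt0r_neq0 s0; have nL := lt0r_neq0 L0.
have -> : L * Theta (s / L) = s ^+ 2 / L * expR (- L ^+ 2 / (s ^+ 2 *+ 2)).
  rewrite /Theta mulf_eq0 invr_eq0 (negbTE ns) (negbTE nL)/= mulrA; congr (_ * expR _).
    by field; rewrite nL.
  by field; rewrite nL ns.
set K := _ * _.
have K0 : 0 <= K by rewrite mulr_ge0 ?expR_ge0// divr_ge0 ?sqr_ge0// ltW.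
have mm : measurable_fun setT (fun x : R => (Num.max (x - L) 0)%:E).
  by apply/measurable_EFinP; apply: measurable_maxr => //; exact: measurable_funB.
rewrite ge0_integral_normal_prob//; last by move=> x; rewrite lee_fin le_max lexx orbT.
apply: (@le_trans _ _ (\int[mu]_x (K%:E * (normal_pdf L s x)%:E))%E); last first.
  rewrite ge0_integralZl_EFin//.
  - by rewrite integral_normal_pdf mule1.
  - by move=> x _; rewrite lee_fin normal_pdf_ge0.
  - by apply/measurable_EFinP; exact: measurable_normal_pdf.
apply: ge0_le_integral => //.
- by move=> x _; rewrite -EFinM lee_fin mulr_ge0 ?normal_pdf_ge0// le_max lexx orbT.
- by apply: emeasurable_funM => //; apply/measurable_EFinP; exact: measurable_normal_pdf.
- by apply: emeasurable_funM => //; apply/measurable_EFinP; exact: measurable_normal_pdf.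
move=> x _; rewrite -!EFinM lee_fin.
have [xL|xL] := leP (x - L) 0.
  by rewrite mul0r mulr_ge0 ?normal_pdf_ge0.
rewrite !normal_pdf_pos// subr0 /K mulrCA -[X in _ <= X]mulrCA.
have c0 : 0 <= (s * Num.sqrt (pi *+ 2))^-1.
  by rewrite invr_ge0 mulr_ge0 ?sqrtr_ge0// ltW.
rewrite ler_wpM2l//.
set y := x - L in xL *.
(* The bound u <= exp u at u = y L / s^2 lets the cross term of the square absorb the factor y = x -
   L, at the cost of s^2 / L. *)
have e1 : y * L / s ^+ 2 <= expR (y * L / s ^+ 2).
  by rewrite (le_trans _ (expR_ge1Dx _))// lerDr.
have -> : expR (- x ^+ 2 / (s ^+ 2 *+ 2)) =
   expR (- L ^+ 2 / (s ^+ 2 *+ 2)) * expR (- y ^+ 2 / (s ^+ 2 *+ 2))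
   * (expR (y * L / s ^+ 2))^-1.
  by rewrite -expRN -!expRD; congr expR; rewrite /y; field.
set A := expR (- L ^+ 2 / _); set B := expR (- y ^+ 2 / _).
have -> : y * (A * B / expR (y * L / s ^+ 2)) = A * B * (y / expR (y * L / s ^+ 2)).
  by ring.
have -> : s ^+ 2 / L * A * B = A * B * (s ^+ 2 / L) by ring.
rewrite ler_wpM2l ?mulr_ge0 ?expR_ge0//.
rewrite ler_pdivrMr ?expR_gt0//.
have yE : y = s ^+ 2 / L * (y * L / s ^+ 2) by field; rewrite nL ns.
rewrite [leLHS]yE.
by rewrite ler_wpM2l// divr_ge0 ?sqr_ge0// ltW.
Qed.

Let c2pi_bounds : 2 <= Num.sqrt ((pi : R) *+ 2) <= 3.

Proof.
have h := @pi_ge2 R; have h4 := @pihalf_lt2 R.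
have p0 := @pi_gt0 R.
apply/andP; split.
  rewrite -[leLHS](@ger0_norm _ 2)// -sqrtr_sqr ler_sqrt; last by rewrite mulrn_wge0// pi_ge0.
  by rewrite -mulr_natr; lra.
rewrite -[leRHS](@ger0_norm _ 3)// -sqrtr_sqr ler_sqrt//.
by rewrite -mulr_natr; lra.
Qed.

Definition symm_itv (u : R) : set R := [set x | `|x| <= u].

Lemma symm_itvE u : symm_itv u = `[- u, u]%classic.
Proof. by apply/seteqP; split => x; rewrite /symm_itv/= in_itv/= ler_norml. Qed.

Lemma measurable_symm_itv u : measurable (symm_itv u).
Proof. by rewrite symm_itvE. Qed.

(** Length 2 u times the peak of the density, with sqrt (2 pi) >= 2. *)
Lemma normal_small_ball s u : 0 < s -> 0 <= u ->
  (normal_prob 0 s (symm_itv u) <= (u / s)%:E)%E.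
Proof.
move=> s0 u0; have /andP[c2 c3] := c2pi_bounds.
rewrite /normal_prob symm_itvE.
apply: (@le_trans _ _ (\int[mu]_(x in `[(- u)%R, u]%classic) (normal_peak s)%:E)%E).
  apply: ge0_le_integral => //.
  - by move=> x _; rewrite lee_fin normal_pdf_ge0.
  - apply/measurable_EFinP; apply: measurable_funTS; exact: measurable_normal_pdf.
  - by move=> x _; rewrite lee_fin normal_pdf_ub// lt0r_neq0.
rewrite integral_cst//= lebesgue_measure_itv/= lte_fin.
case: ifPn => [_|_]; last by rewrite mule0 lee_fin divr_ge0// ltW.
rewrite -EFinD -EFinM lee_fin opprK normal_peak_pos// -ler_pdivlMl ?invr_gt0 ?mulr_gt0//; last lra.
rewrite invrK mulrACA mulrC.
rewrite (_ : _ * _ = u * Num.sqrt (pi *+ 2)); first by nra.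
by field; rewrite lt0r_neq0.
Qed.

(** Only the interval from u to u + s is kept. There (u + s)^2 <= 2 u^2 + 2 s^2 bounds the density
    below by [p], and 12 = 3 * 4 comes from sqrt (2 pi) <= 3 and e <= 4. *)
Lemma normal_tail_lower s u : 0 < s -> 0 <= u ->
  ((expR (- (u / s) ^+ 2) / 12)%:E <= normal_prob 0 s (~` symm_itv u))%E.
Proof.
move=> s0 u0; have /andP[c2 c3] := c2pi_bounds.
have us : u < u + s by rewrite ltrDl.
pose p := (s * Num.sqrt (pi *+ 2))^-1 * expR (- (u / s) ^+ 2 - 1).
have p0 : 0 <= p.
  by rewrite mulr_ge0 ?expR_ge0// invr_ge0 mulr_ge0 ?sqrtr_ge0// ltW.
have mp A : measurable A -> measurable_fun A (fun x : R => (normal_pdf 0 s x)%:E).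
  by move=> mA; apply/measurable_EFinP; apply: measurable_funTS; exact: measurable_normal_pdf.
rewrite /normal_prob symm_itvE.
apply: (@le_trans _ _ (\int[mu]_(x in `]u, (u + s)%R]%classic) (normal_pdf 0 s x)%:E)%E); last first.
  apply: ge0_subset_integral => //.
  - exact: measurableC.
  - by apply: mp; exact: measurableC.
  - by move=> x _; rewrite lee_fin normal_pdf_ge0.
  - move=> x /=; rewrite !in_itv/= => /andP[ux _].
    by apply/negP; rewrite negb_and orbC -ltNge ux.
apply: (@le_trans _ _ (\int[mu]_(x in `]u, (u + s)%R]%classic) p%:E)%E); last first.
  apply: ge0_le_integral => //.
  - by apply: mp.
  - move=> x /=; rewrite in_itv/= => /andP[ux xs]; rewrite lee_fin normal_pdf_pos// subr0.
    rewrite ler_wpM2l ?invr_ge0 ?mulr_ge0 ?sqrtr_ge0// ?(ltW s0)// ler_expR.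
    rewrite mulNr -opprD lerN2 ler_pdivrMr ?mulrn_wgt0 ?exprn_gt0//.
    have -> : ((u / s) ^+ 2 + 1) * (s ^+ 2 *+ 2) = 2 * u ^+ 2 + 2 * s ^+ 2.
      by field; rewrite lt0r_neq0.
    have x0 : 0 <= x by rewrite (le_trans u0)// ltW.
    have : x ^+ 2 <= (u + s) ^+ 2 by rewrite ler_sqr ?nnegrE// (le_trans x0).
    by have := sqr_ge0 (u - s); lra.
rewrite integral_cst//= lebesgue_measure_itv/= lte_fin us -EFinD -EFinM lee_fin.
rewrite addrAC subrr add0r /p.
rewrite expRD invfM mulrAC !mulrA (mulrAC s^-1) mulVf ?lt0r_neq0// mul1r.
(* From exp(- 1 / 2) >= 1 - 1 / 2, by inverting and squaring. *)
have e3 : expR 1 <= 4 :> R.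
  have h : (expR 2^-1)^-1 >= 2^-1 :> R.
    by rewrite -expRN (le_trans _ (expR_ge1Dx _))//; lra.
  have h2 : expR 2^-1 <= 2 :> R by rewrite -lef_pV2 ?posrE ?expR_gt0.
  have -> : 1 = 2^-1 + 2^-1 :> R by lra.
  by rewrite expRD; have := @expR_gt0 R 2^-1; nra.
have e0 := @expR_gt0 R (- (u / s) ^+ 2).
rewrite -mulrA [X in _ <= X]mulrC -mulrA ler_wpM2l ?(ltW e0)// expRN.
rewrite -invfM lef_pV2 ?posrE ?mulr_gt0 ?expR_gt0//; last lra.
by have := @expR_gt0 R 1; nra.
Qed.

End gauss_functional.

(** * Gaussian variables and their characteristic functions *)

Section theta.
Context {R : realType}.
Implicit Types x y c : R.

Lemma Theta0 : Theta (0 : R) = 0. Proof. by rewrite /Theta eqxx. Qed.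

Lemma ThetaE x : x != 0 -> Theta x = x ^+ 2 * expR (- (x ^+ 2 *+ 2)^-1).
Proof. by rewrite /Theta => /negbTE ->. Qed.

Lemma Theta_ge0 x : 0 <= Theta x.
Proof.
by rewrite /Theta; case: eqP => // _; rewrite mulr_ge0 ?sqr_ge0 ?expR_ge0.
Qed.

Lemma le_Theta x y : 0 <= x -> x <= y -> Theta x <= Theta y.
Proof.
rewrite le_eqVlt => /predU1P[<- _|x0 xy]; first by rewrite Theta0 Theta_ge0.
have y0 := lt_le_trans x0 xy.
rewrite !ThetaE ?lt0r_neq0// ler_pM ?sqr_ge0 ?expR_ge0//.
  by rewrite ler_sqr// nnegrE ltW.
rewrite ler_expR lerN2 lef_pV2 ?posrE ?mulrn_wgt0 ?exprn_gt0//.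
by rewrite lerMn2r/= ler_sqr// nnegrE ltW.
Qed.

(** The quadratic factor scales exactly and the exponential factor of [Theta] is nondecreasing in
    x. *)
Lemma Theta_div_le x c : 0 <= x -> 1 <= c -> Theta (x / c) <= Theta x / c ^+ 2.
Proof.
move=> + c1; have c0 : 0 < c by rewrite (lt_le_trans _ c1).
rewrite le_eqVlt => /predU1P[<-|x0]; first by rewrite mul0r Theta0 mul0r.
rewrite !ThetaE ?lt0r_neq0 ?divr_gt0// expr_div_n mulrAC ler_wpM2r//.
  by rewrite invr_ge0 sqr_ge0.
rewrite ler_wpM2l ?sqr_ge0// ler_expR lerN2 lef_pV2 ?posrE ?mulrn_wgt0 ?divr_gt0 ?exprn_gt0//.
by rewrite lerMn2r/= ler_pdivrMr ?exprn_gt0// ler_peMr ?sqr_ge0// exprn_ege1.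
Qed.

End theta.

Lemma cos_mul_cos {R : realType} (a b : R) :
  cos a * cos b = 2^-1 * cos (a + b) + 2^-1 * cos (a - b).
Proof. by rewrite cosD cosB; lra. Qed.

(** * One-dimensional Gaussian laws and their determination by cosines *)

Section gaussian_variable.
Context {R : realType} {d : measure_display} {T : measurableType d}.
Variable P : probability T R.
Implicit Types (Y : T -> R) (s u L : R).

Lemma ge0_integral_law Y (nu : {measure set (measurableTypeR R) -> \bar R}) (f : R -> \bar R) :
  measurable_fun setT Y -> (forall B, measurable B -> P (Y @^-1` B) = nu B) ->
  measurable_fun setT f -> (forall x, 0 <= f x)%E ->
  (\int[P]_w f (Y w) = \int[nu]_x f x)%E.
Proof.
move=> mY lawY mf f0.
have mY' : measurable_fun setT (Y : T -> measurableTypeR R) by exact: mY.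
pose Y' : {mfun T >-> measurableTypeR R} :=
  HB.pack Y (isMeasurableFun.Build _ _ T (measurableTypeR R) Y mY').
have := @ge0_integral_pushforward _ _ _ _ _ Y' (@measurable_funP _ _ _ _ _ Y')
  P setT f measurableT mf (fun y _ => f0 y).
rewrite preimage_setT => <-; apply: eq_measure_integral => A mA _.
exact: lawY.
Qed.

Lemma Ex_law Y (nu : probability (measurableTypeR R) R) (h : R -> R) :
  measurable_fun setT Y -> (forall B, measurable B -> P (Y @^-1` B) = nu B) ->
  bounded_measurable h -> Ex P (fun w => h (Y w)) = Ex nu h.
Proof.
move=> mY lawY [mh [M hM]].
have bh : bounded_measurable h by split => //; exists M.
have bhY : bounded_measurable (fun w => h (Y w)).
  by split; [exact: measurableT_comp | exists M].
have h0 x : 0 <= M + h x by have := hM x; rewrite ler_norml; lra.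
apply: (@addrI _ M).
rewrite -[X in X + _ = _](Ex_cst P M) -[X in _ = X + _](Ex_cst nu M).
rewrite -!ExD//; [|exact: bm_cst|exact: bm_cst].
apply: EFin_inj; rewrite !EFin_Ex; [|by apply: bmD => //; exact: bm_cst..].
apply: (ge0_integral_law Y nu (fun x => (M + h x)%:E)) => //.
- by apply/measurable_EFinP; exact: measurable_funD.
Qed.

(** [centered_gaussian_real] with the standard deviation exposed; its two cases are those of
    [gaussE]. *)
Definition is_gauss Y s := measurable_fun setT Y /\
  ((s = 0 /\ forall B : set R, measurable B -> P (Y @^-1` B) = \d_(0 : R) B) \/
   (0 < s /\ forall B : set R, measurable B -> P (Y @^-1` B) = normal_prob 0 s B)).

Lemma centered_gaussian_realP Y :
  centered_gaussian_real P Y <-> exists s, is_gauss Y s.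
Proof.
split.
  move=> [mY [h|[s [s0 h]]]]; first by exists 0; split => //; left.
  by exists s; split => //; right.
move=> [s [mY [[_ h]|[s0 h]]]]; split => //; first by left.
by right; exists s.
Qed.

Section facts.
Variables (Y : T -> R) (s : R).
Hypothesis gY : is_gauss Y s.

Lemma is_gauss_ge0 : 0 <= s.
Proof. by case: gY => _ [[-> //]|[/ltW]]. Qed.

Lemma is_gauss_Ex (h : R -> R) : bounded_measurable h ->
  Ex P (fun w => h (Y w)) = gaussE s h.
Proof.
move=> bh; case: gY => mY [[-> law]|[s0 law]].
  rewrite gaussE0 (Ex_law Y (\d_(0 : measurableTypeR R)) h mY law bh) /Ex /Rintegral.
  by rewrite integral_dirac// ?diracT ?mul1e//; apply/measurable_EFinP; case: bh.
rewrite gaussE_pos//; exact: (Ex_law Y (normal_prob 0 s) h mY law bh).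
Qed.

Lemma is_gauss_var : (\int[P]_w (Y w ^+ 2)%:E = (s ^+ 2)%:E)%E.
Proof.
have m2 : measurable_fun setT (fun x : R => (x ^+ 2)%:E).
  by apply/measurable_EFinP; exact: measurable_funX.
have p2 (x : R) : (0 <= (x ^+ 2)%:E)%E by rewrite lee_fin sqr_ge0.
case: gY => mY [[-> law]|[s0 law]].
  rewrite (ge0_integral_law Y (\d_(0 : measurableTypeR R)) (fun x => (x ^+ 2)%:E) mY law m2 p2).
  by rewrite integral_dirac// diracT mul1e.
rewrite -normal_second_moment//.
exact: (ge0_integral_law Y (normal_prob 0 s) (fun x => (x ^+ 2)%:E) mY law m2 p2).
Qed.

Lemma is_gauss_excess L : 0 < L ->
  (\int[P]_w (Num.max (Y w - L) 0)%:E <= (L * Theta (s / L))%:E)%E.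
Proof.
move=> L0.
have m2 : measurable_fun setT (fun x : R => (Num.max (x - L) 0)%:E).
  by apply/measurable_EFinP; apply: measurable_maxr => //; exact: measurable_funB.
have p2 (x : R) : (0 <= (Num.max (x - L) 0)%:E)%E by rewrite lee_fin le_max lexx orbT.
case: gY => mY [[-> law]|[s0 law]].
  rewrite (ge0_integral_law Y (\d_(0 : measurableTypeR R)) (fun x => (Num.max (x - L) 0)%:E) mY law m2 p2).
  rewrite integral_dirac// diracT mul1e sub0r mul0r Theta0 mulr0 lee_fin ge_max lexx.
  by rewrite oppr_le0 ltW.
apply: le_trans (normal_excess s L s0 L0).
by rewrite (ge0_integral_law Y (normal_prob 0 s) (fun x => (Num.max (x - L) 0)%:E) mY law m2 p2).
Qed.

Lemma is_gauss_small_ball u : 0 < s -> 0 <= u ->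
  (P (Y @^-1` symm_itv u) <= (u / s)%:E)%E.
Proof.
move=> s0 u0; case: gY => mY [[e _]|[_ law]]; first by rewrite e ltxx in s0.
rewrite law; last exact: measurable_symm_itv.
exact: normal_small_ball.
Qed.

Lemma is_gauss_tail_lower u : 0 < s -> 0 <= u ->
  ((expR (- (u / s) ^+ 2) / 12)%:E <= P (Y @^-1` (~` symm_itv u)))%E.
Proof.
move=> s0 u0; case: gY => mY [[e _]|[_ law]]; first by rewrite e ltxx in s0.
rewrite law; last by apply: measurableC; exact: measurable_symm_itv.
exact: normal_tail_lower.
Qed.

End facts.

Lemma cvg_gaussE s (h_ : nat -> R -> R) h (M : R) :
  (forall n, measurable_fun setT (h_ n)) -> (forall n x, `|h_ n x| <= M) ->
  (forall x, h_ ^~ x @ \oo --> h x) -> gaussE s (h_ n) @[n --> \oo] --> gaussE s h.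
Proof.
move=> mh hM ch; rewrite /gaussE; case: eqP => _; first exact: ch.
exact: (cvg_Ex (normal_prob 0 s) h_ h M mh hM ch).
Qed.

Lemma probability_unique_halfline (mu nu : probability (measurableTypeR R) R) :
  (forall c : R, mu `[c, +oo[%classic = nu `[c, +oo[%classic) ->
  forall B, measurable B -> mu B = nu B.
Proof.
move=> e B mB.
apply: (@measure_unique _ R (measurableTypeR R) (@RGenCInfty.G R)
  (fun n => `[- n%:R, +oo[%classic)) => //.
- exact: RGenCInfty.measurableE.
- move=> _ _ [x ->] [y ->]; exists (Num.max x y); apply/seteqP; split => z /=.
    by rewrite !in_itv/= !andbT ge_max => -[-> ->].
  by rewrite !in_itv/= !andbT ge_max => /andP[].
- by move=> n; exists (- n%:R).
- apply/seteqP; split => // x _; exists (Num.truncn `|x|).+1 => //=.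
  rewrite in_itv/= andbT lerNl (le_trans (ler_norm _))// normrN.
  by apply: ltW; exact: truncnS_gt.
- by move=> _ [x ->]; exact: e.
- by move=> k; rewrite (le_lt_trans (probability_le1 _ _)) ?ltry.
Qed.

(** The phase c makes cosines carry the sine part too, so the hypothesis is equality of
    characteristic functions. The test functions h for which it persists with the extra factor h
    form a class stable under cosines, by the product formula; it therefore contains the half-lines,
    and these determine the law. *)
Lemma is_gauss_of_char Y s : measurable_fun setT Y -> 0 <= s ->
  (forall t c : R, Ex P (fun w => cos (t * Y w + c)) =
                   gaussE s (fun x => cos (t * x + c))) ->
  is_gauss Y s.
Proof.
move=> mY s0 hchar.
pose H (h : R -> R) := bounded_measurable h /\ forall t c : R,
  Ex P (fun w => h (Y w) * cos (t * Y w + c)) = gaussE s (fun x => h x * cos (t * x + c)).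
have mlin t c : measurable_fun setT (fun x : R => t * x + c).
  by apply: measurable_funD => //; apply: measurable_funM.
have mlinY t c : measurable_fun setT (fun w => t * Y w + c).
  by apply: measurable_funD => //; apply: measurable_funM.
have bmY (h : R -> R) : bounded_measurable h -> bounded_measurable (fun w => h (Y w)).
  by move=> [mh [M hM]]; split; [exact: measurableT_comp | exists M].
have Hlin : linear_class H.
  move=> a b f g [bf Hf] [bg Hg]; split; first by apply: bmD; exact: bmZ.
  move=> t c.
  have -> : (fun x => (a * f x + b * g x) * cos (t * x + c)) =
      (fun x => a * (f x * cos (t * x + c)) + b * (g x * cos (t * x + c))).
    by apply/funext => x; ring.
  have bc := bm_cos _ (mlin t c); have bcY := bm_cos _ (mlinY t c).
  rewrite (gaussE_lin s a b _ _ (bmM _ _ bf bc) (bmM _ _ bg bc)) -Hf -Hg.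
  have b1 := bmM _ _ (bmY _ bf) bcY; have b2 := bmM _ _ (bmY _ bg) bcY.
  rewrite -(ExZ P a _ b1) -(ExZ P b _ b2) -(ExD P _ _ (bmZ a _ b1) (bmZ b _ b2)).
  by congr Ex; apply/funext => w; ring.
have Hbd : bounded_class H by move=> f [[_ ?] _].
have Hlim : limit_class H.
  move=> f_ f M Hf fM cf; split.
    by apply: (bm_lim f_ f M) => // n; case: (Hf n) => -[].
  move=> t c.
  have bc := bm_cos _ (mlin t c); have bcY := bm_cos _ (mlinY t c).
  have cos1 (x : R) : `|cos x| <= 1 by rewrite ler_norml cos_geN1 cos_le1.
  have M0 : 0 <= M by rewrite (le_trans _ (fM 0%N 0)).
  have l1 : Ex P (fun w => f_ n (Y w) * cos (t * Y w + c)) @[n --> \oo] -->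
      Ex P (fun w => f (Y w) * cos (t * Y w + c)).
    apply: (cvg_Ex P _ _ M) => [n|n w|w].
    - by have [bn _] := Hf n; have [] := bmM _ _ (bmY _ bn) bcY.
    - by rewrite normrM -[X in _ <= X]mulr1 ler_pM.
    - by apply: cvgM; [exact: cf | exact: cvg_cst].
  have l2 : gaussE s (fun x => f_ n x * cos (t * x + c)) @[n --> \oo] -->
      gaussE s (fun x => f x * cos (t * x + c)).
    apply: (cvg_gaussE s _ _ M) => [n|n w|w].
    - by have [bn _] := Hf n; have [] := bmM _ _ bn bc.
    - by rewrite normrM -[X in _ <= X]mulr1 ler_pM.
    - by apply: cvgM; [exact: cf | exact: cvg_cst].
  have e n : Ex P (fun w => f_ n (Y w) * cos (t * Y w + c)) =
     gaussE s (fun x => f_ n x * cos (t * x + c)) by case: (Hf n) => _; exact.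
  rewrite (funext e) in l1.
  by rewrite -(cvg_lim _ l1)// -(cvg_lim _ l2).
have Hcos f (t c : R) : H f -> H (fun x => f x * cos (t * x + c)).
  move=> [bf Hf]; split; first exact: bmM bf (bm_cos _ (mlin t c)).
  move=> t' c'.
  have e (x : R) : cos (t * x + c) * cos (t' * x + c') =
     2^-1 * cos ((t + t') * x + (c + c')) + 2^-1 * cos ((t - t') * x + (c - c')).
    have -> : (t + t') * x + (c + c') = (t * x + c) + (t' * x + c') by ring.
    have -> : (t - t') * x + (c - c') = (t * x + c) - (t' * x + c') by ring.
    exact: cos_mul_cos.
  have -> : (fun x => f x * cos (t * x + c) * cos (t' * x + c')) = (fun x =>
      2^-1 * (f x * cos ((t + t') * x + (c + c'))) +
      2^-1 * (f x * cos ((t - t') * x + (c - c')))).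
    by apply/funext => x; rewrite -mulrA e; ring.
  have -> : (fun w => f (Y w) * cos (t * Y w + c) * cos (t' * Y w + c')) = (fun w =>
      2^-1 * (f (Y w) * cos ((t + t') * Y w + (c + c'))) +
      2^-1 * (f (Y w) * cos ((t - t') * Y w + (c - c')))).
    by apply/funext => x; rewrite -mulrA e; ring.
  have bb a b := bmM _ _ bf (bm_cos _ (mlin a b)).
  have bbY a b := bmM _ _ (bmY _ bf) (bm_cos _ (mlinY a b)).
  rewrite (gaussE_lin s _ _ _ _ (bb _ _) (bb _ _)) -!Hf.
  by rewrite (ExD P _ _ (bmZ _ _ (bbY _ _)) (bmZ _ _ (bbY _ _))) !(ExZ P _ _ (bbY _ _)).
have H1 : H (fun=> 1).
  split; first exact: bm_cst.
  move=> t c; under eq_fun do rewrite mul1r; rewrite hchar.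
  by congr gaussE; apply/funext => x; rewrite mul1r.
have mcy c : measurable (`[c, +oo[%classic : set R) by exact: measurable_itv.
have stepE (c x : R) : step c x = \1_(`[c, +oo[%classic) x.
  by rewrite /step indicE mem_setE in_itv/= andbT.
have Hstep c : Ex P (fun w => step c (Y w)) = gaussE s (step c).
  have [_ /(_ 0 0)] := trig_class_halfline H Hlin Hlim Hbd id Hcos _ c H1.
  have -> : (fun x => 1 * step c (id x) * cos (0 * x + 0)) = step c.
    by apply/funext => x; rewrite mul0r addr0 cos0 mulr1 mul1r.
  by move=> <-; congr Ex; apply/funext => x; rewrite mul0r addr0 cos0 mulr1 mul1r.
have Pc c : P (Y @^-1` `[c, +oo[%classic) = (gaussE s (step c))%:E.
  rewrite -Hstep -Ex_indic; last by rewrite -[X in measurable X]setTI; exact: mY.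
  congr (_)%:E; congr Ex; apply/funext => w; rewrite stepE.
  by rewrite !indicE !mem_setE.
have mY' : measurable_fun setT (Y : T -> measurableTypeR R) by exact: mY.
pose Y' : {mfun T >-> measurableTypeR R} :=
  HB.pack Y (isMeasurableFun.Build _ _ T (measurableTypeR R) Y mY').
split => //; move: s0; rewrite le_eqVlt => /predU1P[s0|s0]; [left|right]; split => // B mB.
  apply: (probability_unique_halfline (distribution P Y') (\d_(0 : measurableTypeR R))) => // c.
  rewrite -[LHS]/(P (Y @^-1` `[c, +oo[%classic)) Pc -s0 gaussE0 stepE.
  by rewrite indicE.
apply: (probability_unique_halfline (distribution P Y') (normal_prob 0 s)) => // c.
rewrite -[LHS]/(P (Y @^-1` `[c, +oo[%classic)) Pc gaussE_pos//.
rewrite -(Ex_indic (normal_prob 0 s))//; congr (_)%:E; congr Ex.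
by apply/funext => x; rewrite stepE.
Qed.

End gaussian_variable.

(** * Gaussian spaces and independence of X + Y and X - Y *)

Section gaussian_space.
Context {R : realType} {d : measure_display} {T : measurableType d}.
Variable P : probability T R.

(** Written as in the weak variances of the theorem, so that the two agree by conversion; for
    Gaussian [f] the integral is finite by [is_gauss_var]. *)
Definition std (f : T -> R) : R := Num.sqrt (fine (\int[P]_w (f w ^+ 2)%:E)%E).

Lemma is_gauss_std f s : is_gauss P f s -> std f = s.
Proof.
move=> gf; rewrite /std (is_gauss_var P f s gf) sqrtr_sqr ger0_norm//.
exact: (is_gauss_ge0 P f s gf).
Qed.

Variable H : (T -> R) -> Prop.
Hypotheses (Hlin : linear_class H)
  (Hgauss : forall f, H f -> centered_gaussian_real P f).
Implicit Types (f g : T -> R) (s t a c : R).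

Lemma std_gauss f : H f -> is_gauss P f (std f).
Proof.
by move=> /Hgauss/centered_gaussian_realP[s gf]; rewrite (is_gauss_std _ _ gf).
Qed.

Let mH f : H f -> measurable_fun setT f.
Proof. by move=> /std_gauss[]. Qed.

Let stdE f : H f -> ((std f ^+ 2)%:E = \int[P]_w (f w ^+ 2)%:E)%E.
Proof. by move=> /std_gauss/is_gauss_var ->. Qed.

Let HD f g : H f -> H g -> H (fun w => f w + g w).
Proof.
move=> Hf Hg; have := Hlin 1 1 _ _ Hf Hg; congr H.
by apply/funext => w; rewrite !mul1r.
Qed.

Let HB f g : H f -> H g -> H (fun w => f w - g w).
Proof.
move=> Hf Hg; have := Hlin 1 (-1) _ _ Hf Hg; congr H.
by apply/funext => w; rewrite mul1r mulN1r.
Qed.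

Let HZ a f : H f -> H (fun w => a * f w).
Proof.
move=> Hf; have := Hlin a 0 _ _ Hf Hf; congr H.
by apply/funext => w; rewrite mul0r addr0.
Qed.

Lemma std_ge0 f : 0 <= std f. Proof. exact: sqrtr_ge0. Qed.

Lemma stdZ a f : H f -> std (fun w => a * f w) = `|a| * std f.
Proof.
move=> Hf; apply/eqP; rewrite -(@eqrXn2 _ 2)// ?mulr_ge0 ?std_ge0//.
rewrite exprMn real_normK ?num_real//; apply/eqP; apply: EFin_inj.
rewrite [RHS]EFinM (stdE _ (HZ a _ Hf)) (stdE _ Hf) -ge0_integralZl_EFin ?sqr_ge0//.
- by apply: eq_integral => w _; rewrite -EFinM exprMn.
- by move=> w _; rewrite lee_fin sqr_ge0.
- by apply/measurable_EFinP/measurable_funX; exact: mH.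
Qed.

Lemma std_parallelogram f g : H f -> H g ->
  std (fun w => f w + g w) ^+ 2 + std (fun w => f w - g w) ^+ 2 =
  2 * std f ^+ 2 + 2 * std g ^+ 2.
Proof.
move=> Hf Hg; apply: EFin_inj; rewrite !EFinD [X in _ = (X + _)%E]EFinM [X in _ = (_ + X)%E]EFinM.
rewrite (stdE _ (HD _ _ Hf Hg)) (stdE _ (HB _ _ Hf Hg)) (stdE _ Hf) (stdE _ Hg).
have m2 h : H h -> measurable_fun setT (fun w => (h w ^+ 2)%:E).
  by move=> Hh; apply/measurable_EFinP/measurable_funX; exact: mH.
have p2 h : (forall w, setT w -> 0 <= (h w ^+ 2 : R)%:E)%E.
  by move=> w _; rewrite lee_fin sqr_ge0.
rewrite -!ge0_integralZl_EFin//; [|exact: p2|exact: m2|exact: p2|exact: m2].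
rewrite -!ge0_integralD//; first last.
- by apply: m2; exact: HB.
- exact: p2.
- by apply: m2; exact: HD.
- exact: p2.
- by apply: emeasurable_funM => //; exact: m2.
- by move=> w _; rewrite mule_ge0// lee_fin ?sqr_ge0.
- by apply: emeasurable_funM => //; exact: m2.
- by move=> w _; rewrite mule_ge0// lee_fin ?sqr_ge0.
apply: eq_integral => w _; rewrite -!EFinM -!EFinD; congr EFin; ring.
Qed.

Lemma bm_gaussE_cos s t c :
  bounded_measurable (fun y => gaussE s (fun x => cos (t * x + (t * y + c)))).
Proof.
have mlin : measurable_fun setT (fun x : R => t * x + c).
  by apply: measurable_funD => //; apply: measurable_funM.
have e y : gaussE s (fun x => cos (t * x + (t * y + c))) =
      gaussE s (fun x => cos (t * x)) * cos (t * y + c)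
      - gaussE s (fun x => sin (t * x)) * sin (t * y + c).
  by rewrite gaussE_cosD mulrC [X in _ - X]mulrC.
rewrite (funext e).
by apply: bmB; apply: bmZ; [exact: bm_cos|exact: bm_sin].
Qed.

Let measurable_linear t c : measurable_fun setT (fun x : R => t * x + c).
Proof. by apply: measurable_funD => //; apply: measurable_funM. Qed.

Local Notation Q := (P \x P)%E.

Let mfst f : H f -> measurable_fun setT (fun z : T * T => f z.1).
Proof. by move=> Hf; exact: (measurableT_comp (mH _ Hf) measurable_fst). Qed.

Let msnd f : H f -> measurable_fun setT (fun z : T * T => f z.2).
Proof. by move=> Hf; exact: (measurableT_comp (mH _ Hf) measurable_snd). Qed.

(** With (X, Y) the two coordinates of the product space, f(X) and g(Y) are independent: integrating
    out Y leaves a convolution of two Gaussian laws. *)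
Lemma Ex_prod_cos f g t c : H f -> H g ->
  Ex Q (fun z => cos (t * f z.1 + t * g z.2 + c)) =
  gaussE (Num.sqrt (std f ^+ 2 + std g ^+ 2)) (fun x => cos (t * x + c)).
Proof.
move=> Hf Hg; rewrite Ex_prod; last first.
  apply: bm_cos; apply: measurable_funD => //; apply: measurable_funD.
    by apply: measurable_funM => //; exact: mfst.
  by apply: measurable_funM => //; exact: msnd.
have e x : Ex P (fun y => cos (t * f x + t * g y + c)) =
    gaussE (std g) (fun v => cos (t * v + (t * f x + c))).
  rewrite -(is_gauss_Ex P g _ (std_gauss _ Hg)); last exact: bm_cos (measurable_linear _ _).
  by congr Ex; apply/funext => y; congr cos; ring.
rewrite (funext e : (fun x => Ex P (fun y => cos (t * f (x, y).1 + t * g (x, y).2 + c))) = _).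
rewrite (is_gauss_Ex P f _ (std_gauss _ Hf) _ (bm_gaussE_cos (std g) t c)).
by apply: gaussE_convolution; exact: std_ge0.
Qed.

Lemma diff_gauss g : H g ->
  is_gauss Q (fun z => g z.1 - g z.2) (Num.sqrt 2 * std g).
Proof.
move=> Hg; apply: is_gauss_of_char.
- by apply: measurable_funB; [exact: mfst|exact: msnd].
- by rewrite mulr_ge0 ?sqrtr_ge0 ?std_ge0.
move=> t c; have := Ex_prod_cos g (fun w => -1 * g w) t c Hg (HZ _ _ Hg).
rewrite (stdZ (-1) g Hg) normrN1 mul1r.
have -> : Num.sqrt (std g ^+ 2 + std g ^+ 2) = Num.sqrt 2 * std g.
  rewrite -[std g in RHS]ger0_norm ?std_ge0// -sqrtr_sqr -sqrtrM//.
  by congr Num.sqrt; ring.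
by move=> <-; congr Ex; apply/funext => z; congr cos; ring.
Qed.

(** f and -f have the same standard deviation, hence the same law, so the expectation of an odd
    function equals its opposite. *)
Let sin_gauss f : H f -> gaussE (std f) (fun x => sin (1 * x)) = 0.
Proof.
move=> Hf; have bs : bounded_measurable (fun x : R => sin (1 * x)).
  by apply: bm_sin; apply: measurable_funM.
have e1 := is_gauss_Ex P f _ (std_gauss _ Hf) _ bs.
have e2 := is_gauss_Ex P _ _ (std_gauss _ (HZ (-1) _ Hf)) _ bs.
rewrite (stdZ (-1) f Hf) normrN1 mul1r in e2.
have bsf : bounded_measurable (fun w => sin (1 * f w)).
  by apply: bm_sin; apply: measurable_funM => //; exact: mH.
have e3 : Ex P (fun w => sin (1 * (-1 * f w))) = -1 * Ex P (fun w => sin (1 * f w)).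
  rewrite -(ExZ P (-1) _ bsf); congr Ex; apply/funext => w.
  by rewrite mulrCA mulN1r sinN mulN1r.
by rewrite e2 e1 in e3; lra.
Qed.

(* The characteristic function of [X + Y] and [X - Y] factorises: these two
   Gaussian vectors are independent. *)
Lemma sum_diff_char f g a c : H f -> H g ->
  Ex Q (fun z => cos (a * (g z.1 - g z.2) + (f z.1 + f z.2) + c)) =
  gaussE (std (fun w => Num.sqrt 2 * a * g w)) (fun x => cos (1 * x)) *
  Ex Q (fun z => cos (f z.1 + f z.2 + c)).
Proof.
move=> Hf Hg; have Hag := HZ a _ Hg.
have -> : Ex Q (fun z => cos (a * (g z.1 - g z.2) + (f z.1 + f z.2) + c)) =
  Ex Q (fun z => cos (1 * (f z.1 + a * g z.1) + 1 * (f z.2 - a * g z.2) + c)).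
  by congr Ex; apply/funext => z; congr cos; ring.
have -> : Ex Q (fun z => cos (f z.1 + f z.2 + c)) =
  Ex Q (fun z => cos (1 * f z.1 + 1 * f z.2 + c)).
  by congr Ex; apply/funext => z; congr cos; ring.
(* The variances of f + a g at X and of f - a g at Y are added: their cross terms are opposite, and
   the parallelogram identity removes them without naming a covariance. *)
rewrite (Ex_prod_cos _ _ 1 c (HD _ _ Hf Hag) (HB _ _ Hf Hag)) std_parallelogram//.
rewrite (Ex_prod_cos _ _ 1 c Hf Hf).
set s1 := Num.sqrt (std f ^+ 2 + std f ^+ 2).
have s1E : s1 ^+ 2 = 2 * std f ^+ 2.
  by rewrite sqr_sqrtr ?addr_ge0 ?sqr_ge0//; ring.
have Hs := HZ (Num.sqrt 2 * a) _ Hg.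
set s2 := std (fun w => Num.sqrt 2 * a * g w).
have s2E : s2 ^+ 2 = 2 * std (fun w => a * g w) ^+ 2.
  rewrite /s2 !stdZ// !exprMn !real_normK ?num_real// exprMn sqr_sqrtr//; ring.
rewrite -s1E -s2E -(gaussE_convolution s1 s2 1 c (sqrtr_ge0 _) (std_ge0 _)).
have e y : gaussE s2 (fun x => cos (1 * x + (1 * y + c))) =
   gaussE s2 (fun x => cos (1 * x)) * cos (1 * y + c) + 0 * cos (1 * y + c).
  by rewrite gaussE_cosD sin_gauss// mulr0 subr0 mul0r addr0 mulrC.
have bc := bm_cos _ (measurable_linear 1 c).
by rewrite (funext e) (gaussE_lin s1 _ _ _ _ bc bc) mul0r addr0.
Qed.

End gaussian_space.

(** * Independence tested by weighted cosines *)

Section box_independence.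
Context {R : realType} {d : measure_display} {T : measurableType d}.
Variables (Q : probability T R) (U : T -> R) (D : (T -> R) -> Prop) (kappa : R -> R).
Hypotheses (mU : measurable_fun setT U) (mD : forall A, D A -> measurable_fun setT A)
  (D0 : D (fun=> 0)) (Dlin : forall t A V, D A -> D V -> D (fun z => A z + t * V z)).
Hypothesis char : forall a A c, D A ->
  Ex Q (fun z => cos (a * U z + A z + c)) = kappa a * Ex Q (fun z => cos (A z + c)).

(** Weighted by [f], the variable [U] still factors out of every cosine with characteristic function
    [kappa]. Starting from f = 1, weights are enriched up to indicators depending on [D]. *)
Definition indep_weight (f : T -> R) := bounded_measurable f /\
  forall a A c, D A -> Ex Q (fun z => f z * cos (a * U z + A z + c)) =
                       kappa a * Ex Q (fun z => f z * cos (A z + c)).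

Let mA A c : D A -> measurable_fun setT (fun z => A z + c).
Proof. by move=> DA; apply: measurable_funD => //; exact: mD. Qed.

Let maU a A c : D A -> measurable_fun setT (fun z => a * U z + A z + c).
Proof.
move=> DA; apply: measurable_funD => //; apply: measurable_funD; last exact: mD.
exact: measurable_funM.
Qed.

Let cos1 (x : R) : `|cos x| <= 1. Proof. by rewrite ler_norml cos_geN1 cos_le1. Qed.

Lemma indep_weight_linear : linear_class indep_weight.
Proof.
move=> p q f g [bf Hf] [bg Hg]; split; first by apply: bmD; exact: bmZ.
move=> a A c DA.
have e (h : T -> R) : measurable_fun setT h ->
   Ex Q (fun z => (p * f z + q * g z) * cos (h z)) =
   p * Ex Q (fun z => f z * cos (h z)) + q * Ex Q (fun z => g z * cos (h z)).
  move=> mh; have b1 := bmM _ _ bf (bm_cos _ mh); have b2 := bmM _ _ bg (bm_cos _ mh).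
  rewrite -(ExZ Q p _ b1) -(ExZ Q q _ b2) -(ExD Q _ _ (bmZ p _ b1) (bmZ q _ b2)).
  by congr Ex; apply/funext => w; ring.
rewrite e; last exact: maU.
rewrite e; last exact: mA.
by rewrite Hf// Hg//; ring.
Qed.

Lemma indep_weight_bounded : bounded_class indep_weight.
Proof. by move=> f [[_ ?] _]. Qed.

Lemma indep_weight_limit : limit_class indep_weight.
Proof.
move=> f_ f M Hf fM cf; split.
  by apply: (bm_lim f_ f M) => // n; case: (Hf n) => -[].
move=> a A c DA.
have l (h : T -> R) : measurable_fun setT h ->
    Ex Q (fun z => f_ n z * cos (h z)) @[n --> \oo] --> Ex Q (fun z => f z * cos (h z)).
  move=> mh; apply: (cvg_Ex Q _ _ M) => [n|n w|w].
  - by have [bn _] := Hf n; have [] := bmM _ _ bn (bm_cos _ mh).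
  - by rewrite normrM -[X in _ <= X]mulr1 ler_pM.
  - by apply: cvgM; [exact: cf | exact: cvg_cst].
have l1 := l _ (maU a A c DA).
have l2 : kappa a * Ex Q (fun z => f_ n z * cos (A z + c)) @[n --> \oo] -->
    kappa a * Ex Q (fun z => f z * cos (A z + c)).
  by apply: cvgM; [exact: cvg_cst | exact: l (mA _ _ DA)].
have e n : Ex Q (fun z => f_ n z * cos (a * U z + A z + c)) =
   kappa a * Ex Q (fun z => f_ n z * cos (A z + c)) by case: (Hf n) => _; exact.
rewrite (funext e) in l1.
by rewrite -(cvg_lim _ l1)// -(cvg_lim _ l2).
Qed.

(** The product of cos(t V + c) and cos(a U + A + c') splits into cosines with A + t V and A - t V
    in place of A, both still in [D]. *)
Lemma indep_weight_step V c f : D V -> indep_weight f ->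
  indep_weight (fun z => f z * step c (V z)).
Proof.
move=> DV; apply: (trig_class_halfline _ indep_weight_linear indep_weight_limit
  indep_weight_bounded) => {}f t {}c [bf Hf].
split.
  apply: bmM bf (bm_cos _ _); apply: measurable_funD => //.
  by apply: measurable_funM => //; exact: mD.
move=> a A c' DA.
have e (x y : R) : cos (t * x + c) * cos y =
   2^-1 * cos (y + t * x + c) + 2^-1 * cos (y + (- t) * x - c).
  rewrite mulrC cos_mul_cos; congr (_ * cos _ + _ * cos _); ring.
have D1 := Dlin t _ _ DA DV; have D2 := Dlin (- t) _ _ DA DV.
have e2 (h : T -> R) : measurable_fun setT h ->
   Ex Q (fun z => f z * cos (t * V z + c) * cos (h z)) =
   2^-1 * Ex Q (fun z => f z * cos (h z + t * V z + c)) +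
   2^-1 * Ex Q (fun z => f z * cos (h z + (- t) * V z - c)).
  move=> mh.
  have m' u v : measurable_fun setT (fun z => h z + u * V z + v).
    apply: measurable_funD => //; apply: measurable_funD => //.
    by apply: measurable_funM => //; exact: mD.
  have b1 := bmM _ _ bf (bm_cos _ (m' t c)).
  have b2 := bmM _ _ bf (bm_cos _ (m' (- t) (- c))).
  rewrite -(ExZ Q _ _ b1) -(ExZ Q _ _ b2) -(ExD Q _ _ (bmZ _ _ b1) (bmZ _ _ b2)).
  by congr Ex; apply/funext => w; rewrite -mulrA e; ring.
rewrite e2; last exact: maU.
rewrite e2; last exact: mA.
have r1 : Ex Q (fun z => f z * cos (a * U z + A z + c' + t * V z + c)) =
    kappa a * Ex Q (fun z => f z * cos (A z + c' + t * V z + c)).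
  transitivity (Ex Q (fun z => f z * cos (a * U z + (A z + t * V z) + (c' + c)))).
    by congr Ex; apply/funext => z; congr (_ * cos _); ring.
  rewrite (Hf a _ (c' + c) D1); congr (_ * Ex _ _); apply/funext => z.
  by congr (_ * cos _); ring.
have r2 : Ex Q (fun z => f z * cos (a * U z + A z + c' + (- t) * V z - c)) =
    kappa a * Ex Q (fun z => f z * cos (A z + c' + (- t) * V z - c)).
  transitivity (Ex Q (fun z => f z * cos (a * U z + (A z + (- t) * V z) + (c' - c)))).
    by congr Ex; apply/funext => z; congr (_ * cos _); ring.
  rewrite (Hf a _ (c' - c) D2); congr (_ * Ex _ _); apply/funext => z.
  by congr (_ * cos _); ring.
by rewrite r1 r2; ring.
Qed.

Lemma indep_weight1 : indep_weight (fun=> 1).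
Proof.
split; first exact: bm_cst.
move=> a A c DA; under eq_fun do rewrite mul1r; rewrite char//.
by congr (_ * Ex _ _); apply/funext => z; rewrite mul1r.
Qed.

(** The excess (u - L)_+ cut at N, which keeps it inside the calculus of bounded functions. *)
Definition trunc_excess (L N u : R) : R := Num.min (Num.max (u - L) 0) N.

Lemma trunc_excess_ge0 L N u : 0 <= N -> 0 <= trunc_excess L N u.
Proof. by move=> N0; rewrite /trunc_excess le_min N0 le_max lexx orbT. Qed.

Lemma trunc_excess_le L N u : trunc_excess L N u <= N.
Proof. by rewrite /trunc_excess ge_min lexx orbT. Qed.

Lemma bm_trunc_excess (dT : measure_display) (S : measurableType dT) L N (V : S -> R) :
  0 <= N -> measurable_fun setT V -> bounded_measurable (fun z => trunc_excess L N (V z)).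
Proof.
move=> N0 mV; split; last first.
  by exists N => z; rewrite ger0_norm ?trunc_excess_ge0// trunc_excess_le.
apply: measurable_minr => //; apply: measurable_maxr => //.
exact: measurable_funB.
Qed.

Lemma step_trunc_excess L N c u : 0 <= N ->
  step c (trunc_excess L N u) =
  if c <= 0 then 1 else if N < c then 0 else step (L + c) u.
Proof.
move=> N0; rewrite /step; case: (leP c 0) => c0.
  by rewrite (le_trans c0 (trunc_excess_ge0 _ _ _ N0)).
case: (ltP N c) => Nc.
  by rewrite leNgt (le_lt_trans (trunc_excess_le _ _ _) Nc).
by rewrite /trunc_excess le_min Nc andbT le_max [c <= 0]leNgt c0 orbF lerBrDl.
Qed.

(** The centred weight [K] is orthogonal to all cos(a U + c). The class [N2] of bounded f for which
    K f keeps this property contains the half-lines of [U], hence by layer cake the truncated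
    excess. *)
Lemma Ex_indep_weight_excess W L N : indep_weight W -> 0 <= N ->
  Ex Q (fun z => W z * trunc_excess L N (U z)) =
  Ex Q W * Ex Q (fun z => trunc_excess L N (U z)).
Proof.
move=> HW N0; have [bW cW] := HW; pose K z := W z - Ex Q W.
have bK : bounded_measurable K by apply: bmB => //; exact: bm_cst.
have mUc a c : measurable_fun setT (fun z => a * U z + c).
  by apply: measurable_funD => //; exact: measurable_funM.
have bc a c := bm_cos _ (mUc a c).
have charU a c : Ex Q (fun z => cos (a * U z + c)) = kappa a * cos c.
  transitivity (Ex Q (fun z => cos (a * U z + (fun=> 0) z + c))).
    by congr Ex; apply/funext => z; rewrite addr0.
  rewrite (char a (fun=> 0) c D0) -[in RHS](Ex_cst Q (cos c)).
  by congr (_ * Ex _ _); apply/funext => z; rewrite add0r.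
have K0 a c : Ex Q (fun z => K z * cos (a * U z + c)) = 0.
  have -> : (fun z => K z * cos (a * U z + c)) = (fun z =>
      W z * cos (a * U z + (fun=> 0) z + c) - Ex Q W * cos (a * U z + c)).
    by apply/funext => z; rewrite /K addr0; ring.
  rewrite ExB; last 2 first.
  - by apply: bmM => //; apply: bm_cos; exact: maU.
  - exact: bmZ.
  rewrite (cW a (fun=> 0) c D0) (ExZ Q _ _ (bc a c)) charU.
  have -> : (fun z => W z * cos ((fun=> 0) z + c)) = (fun z => cos c * W z).
    by apply/funext => z; rewrite add0r mulrC.
  by rewrite (ExZ Q _ _ bW); ring.
pose N2 (f : T -> R) := bounded_measurable f /\
  forall a c, Ex Q (fun z => K z * f z * cos (a * U z + c)) = 0.
have N2lin : linear_class N2.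
  move=> p q f g [bf Hf] [bg Hg]; split; first by apply: bmD; exact: bmZ.
  move=> a c.
  have b1 := bmM _ _ (bmM _ _ bK bf) (bc a c).
  have b2 := bmM _ _ (bmM _ _ bK bg) (bc a c).
  have -> : (fun z => K z * (p * f z + q * g z) * cos (a * U z + c)) = (fun z =>
      p * (K z * f z * cos (a * U z + c)) + q * (K z * g z * cos (a * U z + c))).
    by apply/funext => z; ring.
  by rewrite (ExD Q _ _ (bmZ p _ b1) (bmZ q _ b2)) (ExZ Q p _ b1) (ExZ Q q _ b2)
    Hf Hg !mulr0 addr0.
have N2bd : bounded_class N2 by move=> f [[_ ?] _].
have N2lim : limit_class N2.
  move=> f_ f M Hf fM cf; split.
    by apply: (bm_lim f_ f M) => // n; case: (Hf n) => -[].
  move=> a c; have [_ [B KB]] := bK.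
  have l : Ex Q (fun z => K z * f_ n z * cos (a * U z + c)) @[n --> \oo] -->
      Ex Q (fun z => K z * f z * cos (a * U z + c)).
    apply: (cvg_Ex Q _ _ (B * M * 1)) => [n|n w|w].
    - by have [bn _] := Hf n; have [] := bmM _ _ (bmM _ _ bK bn) (bc a c).
    - by rewrite !normrM ler_pM ?mulr_ge0// ler_pM.
    - apply: cvgM; last exact: cvg_cst.
      by apply: cvgM; [exact: cvg_cst | exact: cf].
  have e n : Ex Q (fun z => K z * f_ n z * cos (a * U z + c)) = 0.
    by case: (Hf n) => _; exact.
  rewrite (funext e) in l; rewrite -(cvg_lim _ l)//.
  by apply: lim_cst.
have N2cos f (t c : R) : N2 f -> N2 (fun z => f z * cos (t * U z + c)).
  move=> [bf Hf]; split; first by apply: bmM.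
  move=> a c'.
  have b1 := bmM _ _ (bmM _ _ bK bf) (bc (t + a) (c + c')).
  have b2 := bmM _ _ (bmM _ _ bK bf) (bc (t - a) (c - c')).
  have -> : (fun z => K z * (f z * cos (t * U z + c)) * cos (a * U z + c')) = (fun z =>
      2^-1 * (K z * f z * cos ((t + a) * U z + (c + c'))) +
      2^-1 * (K z * f z * cos ((t - a) * U z + (c - c')))).
    apply/funext => z; rewrite mulrA -[LHS]mulrA cos_mul_cos.
    have -> : t * U z + c + (a * U z + c') = (t + a) * U z + (c + c') by ring.
    have -> : t * U z + c - (a * U z + c') = (t - a) * U z + (c - c') by ring.
    by ring.
  by rewrite (ExD Q _ _ (bmZ _ _ b1) (bmZ _ _ b2)) (ExZ Q _ _ b1) (ExZ Q _ _ b2)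
    !Hf mulr0 addr0.
have N21 : N2 (fun=> 1).
  split; first exact: bm_cst.
  move=> a c; rewrite -[RHS](K0 a c); congr Ex; apply/funext => z.
  by rewrite mulr1.
have N2step c : N2 (fun z => step c (U z)).
  have := trig_class_halfline N2 N2lin N2lim N2bd U N2cos _ c N21.
  by congr N2; apply/funext => z; rewrite mul1r.
have [bZ /(_ 0 0) eZ] : N2 (fun z => trunc_excess L N (U z)).
  apply: (class_of_halfline_indic N2 N2lin N2lim _ N) => [z|c].
    by rewrite ger0_norm ?trunc_excess_ge0// trunc_excess_le.
  have -> : (fun z => step c (trunc_excess L N (U z))) =
      (fun z => if c <= 0 then 1 else if N < c then 0 else step (L + c) (U z)).
    by apply/funext => z; rewrite step_trunc_excess.
  have [c0|c0] := boolP (c <= 0); first exact: N21.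
  have [Nc|Nc] := boolP (N < c); last exact: N2step.
  have := N2lin 0 0 _ _ N21 N21; congr N2; apply/funext => z; ring.
apply/eqP; rewrite -subr_eq0 -(ExZ Q _ _ bZ) -ExB; last 2 first.
- exact: bmM.
- exact: bmZ.
rewrite -[X in _ == X]eZ; apply/eqP; congr Ex; apply/funext => z.
by rewrite mul0r addr0 cos0 mulr1 /K; ring.
Qed.

End box_independence.

(** * Concentration of Gaussian maxima *)

Section argmax_weight.
Context {R : realType}.
Variable n : nat.
Implicit Types v : nat -> R.

Definition argmax_ind v k : R := \prod_(j < n) step 0 (v k - v j).

(** Indicator that k is the first index of a maximum, so ties are broken and the weights sum to 1.
    It is a polynomial in [step], the form to which the stability of [indep_weight] applies. *)
Definition argmax_weight v k : R := argmax_ind v k * \prod_(j < k) (1 - argmax_ind v j).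

Let ismax v k := [forall j : 'I_n, v j <= v k].

Let argmax_indE v k : argmax_ind v k = (ismax v k)%:R.
Proof.
rewrite /argmax_ind /step; have [/forallP h|] := boolP (ismax v k).
  by rewrite big1// => j _; rewrite subr_ge0 h.
rewrite negb_forall => /existsP[j vj].
by rewrite (bigD1 j)//= subr_ge0 (negbTE vj) mul0r.
Qed.

Lemma argmax_weight_ge0 v k : 0 <= argmax_weight v k.
Proof.
rewrite /argmax_weight mulr_ge0 ?argmax_indE ?ler0n//; apply: prodr_ge0 => j _.
by rewrite argmax_indE subr_ge0 lern1; case: (ismax _ _).
Qed.

Lemma exists_argmax v : (0 < n)%N -> exists k, (k < n)%N /\ forall j, (j < n)%N -> v j <= v k.
Proof.
elim: n => // m ih _; case: m ih => [_|m /(_ isT)[k [km h]]].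
  by exists 0%N; split => // j; rewrite ltnS leqn0 => /eqP ->.
have [hk|hk] := leP (v k) (v m.+1).
  exists m.+1; split => // j; rewrite ltnS leq_eqVlt => /predU1P[->//|jm].
  by rewrite (le_trans (h _ jm)).
exists k; split; first exact: ltnW.
by move=> j; rewrite ltnS leq_eqVlt => /predU1P[->|/h//]; exact: ltW.
Qed.

Lemma argmax_weight_attained v : (0 < n)%N -> exists k : 'I_n,
  argmax_weight v k = 1 /\ forall j, (j < n)%N -> v j <= v k.
Proof.
move=> n0; pose p k := (k < n)%N && ismax v k.
have exp : exists k, p k.
  have [k [kn h]] := exists_argmax v n0.
  by exists k; rewrite /p kn; apply/forallP => j; exact: h.
case: (ex_minnP exp) => k /andP[kn /forallP hk] mink.
exists (Ordinal kn) => /=; split; last first.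
  by move=> j jn; exact: (hk (Ordinal jn)).
rewrite /argmax_weight argmax_indE.
have -> : ismax v k by apply/forallP.
rewrite mul1r big1// => j _; rewrite argmax_indE.
suff /negbTE -> : ~~ ismax v j by rewrite subr0.
apply/negP => hj; have := mink j; rewrite /p hj andbT (ltn_trans (ltn_ord j) kn).
by move=> /(_ isT); rewrite leqNgt ltn_ord.
Qed.

Lemma sum_argmax_weight v : (0 < n)%N -> \sum_(k < n) argmax_weight v k = 1.
Proof.
move=> n0.
have tel m : \sum_(k < m) argmax_weight v k = 1 - \prod_(j < m) (1 - argmax_ind v j).
  elim: m => [|m ih]; first by rewrite !big_ord0 subrr.
  by rewrite !big_ord_recr/= ih /argmax_weight; ring.
have [k [kn h]] := exists_argmax v n0.
rewrite tel (bigD1 (Ordinal kn))//= argmax_indE.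
have -> : ismax v k by apply/forallP => j; exact: h.
by rewrite subrr mul0r subr0.
Qed.

End argmax_weight.

(** Both the positive part and the cap at N are monotone and subadditive on the relevant range. *)
Lemma min_posD {R : realType} (x y z N : R) : 0 <= N -> x <= y + z ->
  Num.min (Num.max x 0) N <= Num.min (Num.max y 0) N + Num.min (Num.max z 0) N.
Proof.
move=> N0 xyz.
have ub (u : R) : Num.min (Num.max u 0) N <= N by rewrite ge_min lexx orbT.
have lb (u : R) : 0 <= Num.min (Num.max u 0) N by rewrite le_min N0 le_max lexx orbT.
have pos (u : R) : u <= Num.max u 0 /\ 0 <= Num.max u 0.
  by split; rewrite le_max lexx ?orbT.
have [yN|yN] := leP (Num.max y 0) N; last first.
  by have := lb z; have := ub x; lra.
have [zN|zN] := leP (Num.max z 0) N; last first.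
  by have := (pos y).2; have := ub x; lra.
rewrite (@le_trans _ _ (Num.max x 0))// ?ge_min ?lexx//.
have [? ?] := pos y; have [? ?] := pos z.
by rewrite ge_max; apply/andP; split; lra.
Qed.

Section concentration.
Context {R : realType} {d : measure_display} {T : measurableType d}.

Lemma bm_step (dS : measure_display) (S : measurableType dS) (V : S -> R) (c : R) :
  measurable_fun setT V -> bounded_measurable (fun z => step c (V z)).
Proof.
move=> mV; have -> : (fun z => step c (V z)) = \1_(V @^-1` `[c, +oo[%classic).
  apply/funext => z; rewrite /step indicE; congr (nat_of_bool _)%:R.
  by apply/idP/idP; rewrite inE/= in_itv/= andbT.
by apply: bm_indic; rewrite -[X in measurable X]setTI; exact: mV.
Qed.

Lemma bm_argmax_weight (dS : measure_display) (S : measurableType dS) n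
    (V : nat -> S -> R) k : (forall i, measurable_fun setT (V i)) ->
  bounded_measurable (fun z => argmax_weight n (V ^~ z) k).
Proof.
move=> mV; have bi j : bounded_measurable (fun z => argmax_ind n (V ^~ z) j).
  by apply: bm_prod => i; apply: bm_step; exact: measurable_funB.
apply: bmM; first exact: bi.
by apply: bm_prod => j; apply: bmB; [exact: bm_cst | exact: bi].
Qed.

Variables (P : probability T R) (H : (T -> R) -> Prop).
Hypotheses (Hlin : linear_class H)
  (Hgauss : forall f, H f -> centered_gaussian_real P f).
Local Notation Q := (P \x P)%E.

Let mH f : H f -> measurable_fun setT f.
Proof. by move=> /Hgauss[]. Qed.

Variables (G : nat -> T -> R) (n : nat).
Hypotheses (HG : forall i, H (G i)) (n0 : (0 < n)%N).

(** The linear functionals of X + Y. *)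
Let D (A : T * T -> R) := exists f, H f /\ A = fun z => f z.1 + f z.2.

(** The differences of coordinates compared by the argmax at X + Y lie in [D], so the weight arises
    from 1 by finitely many steps and linear combinations. *)
Lemma argmax_weight_indep k (g : T -> R) (kappa : R -> R) : H g ->
  (forall a A c, D A -> Ex Q (fun z => cos (a * (g z.1 - g z.2) + A z + c)) =
     kappa a * Ex Q (fun z => cos (A z + c))) ->
  indep_weight Q (fun z => g z.1 - g z.2) D kappa
    (fun z => argmax_weight n (fun i => G i z.1 + G i z.2) k).
Proof.
move=> Hg char.
have m1 f : H f -> measurable_fun setT (fun z : T * T => f z.1).
  by move=> Hf; exact: (measurableT_comp (mH _ Hf) measurable_fst).
have m2 f : H f -> measurable_fun setT (fun z : T * T => f z.2).
  by move=> Hf; exact: (measurableT_comp (mH _ Hf) measurable_snd).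
have mU : measurable_fun setT (fun z : T * T => g z.1 - g z.2).
  by apply: measurable_funB; [exact: m1|exact: m2].
have mD A : D A -> measurable_fun setT A.
  by move=> [f [Hf ->]]; apply: measurable_funD; [exact: m1|exact: m2].
have Dlin t A V : D A -> D V -> D (fun z => A z + t * V z).
  move=> [f [Hf ->]] [h [Hh ->]]; exists (fun w => 1 * f w + t * h w); split.
    exact: Hlin.
  by apply/funext => z; ring.
set W := indep_weight _ _ _ _.
have Wlin : linear_class W by exact: indep_weight_linear.
have Wstep V c f : D V -> W f -> W (fun z => f z * step c (V z)).
  exact: indep_weight_step.
have W1 : W (fun=> 1) by exact: indep_weight1.
have Wind j f : W f ->
    W (fun z => f z * argmax_ind n (fun i => G i z.1 + G i z.2) j).
  rewrite /argmax_ind; elim: n => [|m ih] Wf.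
    have := Wf; congr W; apply/funext => z; by rewrite big_ord0 mulr1.
  have DV : D (fun z => (G j z.1 + G j z.2) - (G m z.1 + G m z.2)).
    exists (fun w => 1 * G j w + (-1) * G m w); split; first exact: Hlin.
    by apply/funext => z; ring.
  have := Wstep _ 0 _ DV (ih Wf); congr W; apply/funext => z.
  by rewrite big_ord_recr/= mulrA.
have Wprod m f : W f ->
    W (fun z => f z * \prod_(j < m) (1 - argmax_ind n (fun i => G i z.1 + G i z.2) j)).
  move=> Wf; elim: m => [|m ih].
    have := Wf; congr W; apply/funext => z; by rewrite big_ord0 mulr1.
  have := Wlin 1 (-1) _ _ ih (Wind m _ ih); congr W; apply/funext => z.
  by rewrite big_ord_recr/=; ring.
have := Wprod k _ (Wind k _ W1); congr W; apply/funext => z.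
by rewrite mul1r.
Qed.

Variables (f : T -> R) (M S L N : R).
Hypotheses (mf : measurable_fun setT f)
  (fub : forall w i, (i < n)%N -> G i w <= f w)
  (fat : forall w, exists2 i, (i < n)%N & f w = G i w)
  (fmed : 2^-1 <= Ex P (fun w => step (f w) (2 * M)))
  (HS : forall i, (i < n)%N -> std P (G i) <= S)
  (L0 : 0 < L) (N0 : 0 <= N).

Let te := trunc_excess L N.

Let te_le_excess u : te u <= Num.max (u - L) 0.
Proof. by rewrite /te /trunc_excess ge_min lexx. Qed.

Let Ex_te (dS : measure_display) (X : measurableType dS) (mu : probability X R) V s s' :
  is_gauss mu V s -> s <= s' -> Ex mu (fun z => te (V z)) <= L * Theta (s' / L).
Proof.
move=> gV ss'; have [mV _] := gV; have s0 := is_gauss_ge0 _ _ _ gV.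
have le1 : L * Theta (s / L) <= L * Theta (s' / L).
  by rewrite ler_pM2l// le_Theta ?divr_ge0// ?ler_pM2r ?invr_gt0// ltW.
apply: le_trans le1; rewrite -lee_fin EFin_Ex; last exact: bm_trunc_excess.
apply: le_trans (is_gauss_excess _ _ _ gV _ L0).
apply: ge0_le_integral => //.
- by move=> z _; rewrite lee_fin trunc_excess_ge0.
- by apply/measurable_EFinP; have [] := bm_trunc_excess _ _ L N V N0 mV.
- apply/measurable_EFinP; apply: measurable_maxr => //; exact: measurable_funB.
- by move=> z _; rewrite lee_fin te_le_excess.
Qed.

(* With k0 an argmax at X and k1 an argmax at X + Y,
   f(X) + g_k0(Y) <= f(X + Y) = g_k1(X - Y) + 2 g_k1(Y). *)
Theorem gaussian_max_excess :
  Ex P (fun w => trunc_excess (4 * M + 2 * L) N (f w)) <=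
  4 * (L * Theta (Num.sqrt 2 * S / L)).
Proof.
set beta := L * Theta _.
have sqrt2 : 1 <= Num.sqrt 2 :> R by rewrite -[X in X <= _]sqrtr1 ler_sqrt//; lra.
have S0 : 0 <= S by rewrite (le_trans (std_ge0 P (G 0%N)))// HS.
have m1 h : measurable_fun setT h -> measurable_fun setT (fun z : T * T => (h : T -> R) z.1).
  by move=> mh; exact: (measurableT_comp mh measurable_fst).
have m2 h : measurable_fun setT h -> measurable_fun setT (fun z : T * T => (h : T -> R) z.2).
  by move=> mh; exact: (measurableT_comp mh measurable_snd).
have mG i := mH _ (HG i).
pose wS k (z : T * T) := argmax_weight n (fun i => G i z.1 + G i z.2) k.
pose wX k w := argmax_weight n (fun i => G i w) k.
pose A (z : T * T) := \sum_(k < n) wS k z * te (G k z.1 - G k z.2).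
pose B (z : T * T) := \sum_(k < n) wX k z.1 * te (-1 * G k z.2).
pose F (z : T * T) := trunc_excess (4 * M + 2 * L) N (f z.1) * step (f z.2) (2 * M).
have bwS k : bounded_measurable (wS k).
  apply: (bm_argmax_weight _ _ n (fun i z => G i z.1 + G i z.2)) => i.
  by apply: measurable_funD; [exact: m1|exact: m2].
have bwX k : bounded_measurable (wX k) by exact: bm_argmax_weight.
have btU k : bounded_measurable (fun z : T * T => te (G k z.1 - G k z.2)).
  by apply: bm_trunc_excess => //; apply: measurable_funB; [exact: m1|exact: m2].
have btN k : bounded_measurable (fun w => te (-1 * G k w)).
  by apply: bm_trunc_excess => //; exact: measurable_funM.
have bA : bounded_measurable A by apply: bm_sum => k; exact: bmM.
have bB : bounded_measurable B.
  apply: bm_sum => k; apply: bmM; first exact: (bm_fst _ (bwX k)).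
  exact: (bm_snd _ (btN k)).
have bf : bounded_measurable (fun w => trunc_excess (4 * M + 2 * L) N (f w)).
  exact: bm_trunc_excess.
have bs : bounded_measurable (fun w => step (f w) (2 * M)).
  have -> : (fun w => step (f w) (2 * M)) = (fun w => step (- (2 * M)) (- f w)).
    by apply/funext => w; rewrite /step lerN2.
  by apply: bm_step; exact: measurableT_comp.
have bF : bounded_measurable F.
  by apply: bmM; [exact: (bm_fst _ bf)|exact: (bm_snd _ bs)].
have FAB z : F z <= A z + B z.
  have wt0 k (r u : R) : 0 <= r -> 0 <= r * te u.
    by move=> r0; rewrite mulr_ge0// trunc_excess_ge0.
  have A0 : 0 <= A z by apply: sumr_ge0 => k _; apply: wt0 => //; exact: argmax_weight_ge0.
  have B0 : 0 <= B z by apply: sumr_ge0 => k _; apply: wt0 => //; exact: argmax_weight_ge0.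
  rewrite /F /step; case: (leP (f z.2) (2 * M)) => fM; last by rewrite mulr0 addr_ge0.
  rewrite mulr1.
  have [k1 [w1 h1]] := argmax_weight_attained n (fun i => G i z.1 + G i z.2) n0.
  have [k0 [w0 h0]] := argmax_weight_attained n (fun i => G i z.1) n0.
  have A1 : te (G k1 z.1 - G k1 z.2) <= A z.
    rewrite /A (bigD1 k1)//= /wS w1 mul1r lerDl; apply: sumr_ge0 => k _.
    by apply: wt0 => //; exact: argmax_weight_ge0.
  have B1 : te (-1 * G k0 z.2) <= B z.
    rewrite /B (bigD1 k0)//= /wX w0 mul1r lerDl; apply: sumr_ge0 => k _.
    by apply: wt0 => //; exact: argmax_weight_ge0.
  apply: le_trans (lerD A1 B1).
  have fX : f z.1 = G k0 z.1.
    apply/eqP; rewrite eq_le fub// andbT.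
    by have [i ilt ->] := fat z.1; exact: h0.
  have := h1 _ (ltn_ord k0); have := fub z.2 _ (ltn_ord k1).
  rewrite fX /te /trunc_excess mulN1r; move: fM N0 L0.
  move: (f z.2) (G k0 z.1) (G k0 z.2) (G k1 z.1) (G k1 z.2) => y a b p q.
  move=> fM hN hL h2 h3.
  (* On {f(Y) <= 2 M} the term 2 g_k1(Y) is at most 4 M; the margin 2 L is shared equally by the two
     remaining Gaussian terms. *)
  have a0 : a - (4 * M + 2 * L) <= (p - q - L) + (- b - L) by lra.
  move: a0; move: (a - _) (p - q - L) (- b - L) => x1 x2 x3 a0.
  exact: min_posD.
(* Each summand factorises because the weight depends on X + Y and the excess on X - Y; the weights
   then sum to 1, so n does not enter. *)
have EA : Ex Q A <= beta.
  rewrite /A Ex_sum; last by move=> k; exact: bmM.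
  have e k : (k < n)%N -> Ex Q (fun z => wS k z * te (G k z.1 - G k z.2)) <= Ex Q (wS k) * beta.
    move=> kn.
    have char a A' c : D A' ->
       Ex Q (fun z => cos (a * (G k z.1 - G k z.2) + A' z + c)) =
       gaussE (std P (fun w => Num.sqrt 2 * a * G k w)) (fun x => cos (1 * x)) *
       Ex Q (fun z => cos (A' z + c)).
      by move=> [h [Hh ->]]; exact: (sum_diff_char P H Hlin Hgauss).
    have iw := argmax_weight_indep k (G k) _ (HG k) char.
    have -> := Ex_indep_weight_excess Q _ _ _ _ _ _ char _ L N iw N0.
    - apply: ler_wpM2l.
        rewrite -(Ex_cst Q 0); apply: (le_Ex Q _ _ (bm_cst 0) (bwS k)).
        by move=> z; exact: argmax_weight_ge0.
      apply: Ex_te (diff_gauss P H Hlin Hgauss _ (HG k)) _.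
      by rewrite ler_wpM2l ?sqrtr_ge0// HS.
    - by apply: measurable_funB; [exact: m1|exact: m2].
    - by move=> A' [h [Hh ->]]; apply: measurable_funD; [apply: m1|apply: m2]; exact: mH.
    - exists (fun w => 0 * G k w + 0 * G k w); split; first exact: Hlin.
      by apply/funext => z; rewrite !mul0r !addr0.
  apply: (@le_trans _ _ (\sum_(k < n) Ex Q (wS k) * beta)).
    by apply: ler_sum => k _; exact: e.
  rewrite -mulr_suml -Ex_sum//.
  have -> : (fun z => \sum_(k < n) wS k z) = (fun=> 1).
    by apply/funext => z; exact: sum_argmax_weight.
  by rewrite Ex_cst mul1r.
(* Here the weight depends on X and the excess on Y, so the product measure suffices; S <= sqrt 2 S
   lets both terms share [beta]. *)
have EB : Ex Q B <= beta.
  rewrite /B Ex_sum; last first.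
    by move=> k; apply: bmM; [exact: (bm_fst _ (bwX k))|exact: (bm_snd _ (btN k))].
  have e k : (k < n)%N -> Ex Q (fun z => wX k z.1 * te (-1 * G k z.2)) <= Ex P (wX k) * beta.
    move=> kn; rewrite (Ex_prodM P _ _ (bwX k) (btN k)); apply: ler_wpM2l.
      rewrite -(Ex_cst P 0); apply: le_Ex => //; first exact: bm_cst.
      by move=> z; exact: argmax_weight_ge0.
    have HN : H (fun w => -1 * G k w).
      have := Hlin (-1) 0 _ _ (HG k) (HG k); congr H; apply/funext => w; ring.
    apply: Ex_te (std_gauss P H Hgauss _ HN) _.
    rewrite (stdZ P H Hlin Hgauss)// normrN1 mul1r (le_trans (HS _ kn))//.
    by rewrite ler_peMl.
  apply: (@le_trans _ _ (\sum_(k < n) Ex P (wX k) * beta)).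
    by apply: ler_sum => k _; exact: e.
  rewrite -mulr_suml -Ex_sum//.
  have -> : (fun w => \sum_(k < n) wX k w) = (fun=> 1).
    by apply/funext => w; exact: sum_argmax_weight.
  by rewrite Ex_cst mul1r.
have : Ex Q F <= beta + beta.
  by apply: le_trans (lerD EA EB); rewrite -ExD//; apply: le_Ex => //; exact: bmD.
rewrite (Ex_prodM P _ _ bf bs).
have E0 : 0 <= Ex P (fun w => trunc_excess (4 * M + 2 * L) N (f w)).
  rewrite -(Ex_cst P 0); apply: le_Ex => //; first exact: bm_cst.
  by move=> w; exact: trunc_excess_ge0.
(* The expectation of [F] is a product whose second factor is P(f <= 2 M) >= 1 / 2, which turns 2
   beta into 4 beta. *)
move: fmed E0; move: (Ex P _) (Ex P _) => p e hp he; nra.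
Qed.

End concentration.

(** * One Gaussian vector *)

Lemma fatou_le {R : realType} {d : measure_display} {T : measurableType d}
    (P : {measure set T -> \bar R}) (f_ : nat -> T -> R) (f : T -> R) (C : \bar R) :
  (forall n, measurable_fun setT (f_ n)) -> (forall n x, 0 <= f_ n x) ->
  (forall x, f_ ^~ x @ \oo --> f x) ->
  (forall n, \int[P]_x (f_ n x)%:E <= C)%E -> (\int[P]_x (f x)%:E <= C)%E.
Proof.
move=> mf f0 cf fC.
have mfE n : measurable_fun setT (EFin \o f_ n) by exact/measurable_EFinP.
have fE0 n x : setT x -> (0 <= (EFin \o f_ n) x)%E by rewrite lee_fin.
have fat := @fatou _ _ _ P setT measurableT (fun n => EFin \o f_ n) mfE fE0.
have <- : (\int[P]_x limn_einf (fun n => (f_ n x)%:E) = \int[P]_x (f x)%:E)%E.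
  apply: eq_integral => x _.
  have cx : (f_ n x)%:E @[n --> \oo] --> (f x)%:E.
    by apply/fine_cvgP; split; [exact: nearW | exact: cf].
  by rewrite (cvg_limn_einf_sup cx).1.
apply: (le_trans fat); rewrite limn_einf_lim; apply: lime_le.
  exact: is_cvg_einfs.
apply: nearW => n; apply: le_trans (fC n); apply: ereal_inf_lbound.
by exists n => /=.
Qed.

Section gaussian_vector.
Context {R : realType} {d : measure_display} {T : measurableType d}.
Variables (P : probability T R) (X : normedModType R) (x : nat -> X -> R) (xi : T -> X).
Hypotheses (nx : norming_seq x) (gxi : centered_gaussian P x xi).

Definition coordinate_span (g : T -> R) :=
  exists (N : nat) (a : nat -> R), g = fun w => \sum_(k < N) a k * x k (xi w).

Lemma coordinate_span_gauss g : coordinate_span g -> centered_gaussian_real P g.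
Proof. by move=> [N [a ->]]; exact: gxi. Qed.

Let sum_widen n m (F : nat -> R) : (n <= m)%N ->
  \sum_(k < n) F k = \sum_(k < m) (if (k < n)%N then F k else 0).
Proof. by move=> nm; rewrite (big_ord_widen _ _ nm) big_mkcond. Qed.

Lemma coordinate_span_linear : linear_class coordinate_span.
Proof.
move=> a b _ _ [N1 [a1 ->]] [N2 [a2 ->]].
exists (maxn N1 N2), (fun k => a * (if (k < N1)%N then a1 k else 0) +
                               b * (if (k < N2)%N then a2 k else 0)).
apply/funext => w.
rewrite (sum_widen _ _ (fun k => a1 k * x k (xi w)) (leq_maxl N1 N2)).
rewrite (sum_widen _ _ (fun k => a2 k * x k (xi w)) (leq_maxr N1 N2)).
rewrite !mulr_sumr -big_split; apply: eq_bigr => k _ /=.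
by case: ifP => _; case: ifP => _; ring.
Qed.

Lemma coordinate_span_coord (e : R) k : coordinate_span (fun w => e * x k (xi w)).
Proof.
exists k.+1, (fun j => if j == k then e else 0); apply/funext => w.
rewrite (bigD1 ord_max)//= eqxx big1 ?addr0// => j jk.
by rewrite (_ : (j == k :> nat) = false) ?mul0r//; apply/negbTE.
Qed.

Let coord k w := x k (xi w).

Let cspan k : coordinate_span (coord k).
Proof.
have := coordinate_span_coord 1 k; congr coordinate_span.
by apply/funext => w; rewrite mul1r.
Qed.

Lemma measurable_coord k : measurable_fun setT (fun w => x k (xi w)).
Proof. by have [] := coordinate_span_gauss _ (cspan k). Qed.

Lemma coord_gauss k : is_gauss P (fun w => x k (xi w)) (std P (fun w => x k (xi w))).
Proof. exact: (std_gauss P coordinate_span coordinate_span_gauss _ (cspan k)). Qed.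

(** [xi] is seen only through its coordinates; the norm, and its measurability, come as the limit of
    these finite maxima. *)
Fixpoint partial_norm K w : R :=
  if K is k.+1 then Num.max (partial_norm k w) `|x k (xi w)| else 0.

Lemma partial_norm_ge0 K w : 0 <= partial_norm K w.
Proof. by elim: K => //= K ih; rewrite le_max ih. Qed.

Lemma le_partial_norm K w k : (k < K)%N -> `|x k (xi w)| <= partial_norm K w.
Proof.
elim: K => //= K ih; rewrite ltnS leq_eqVlt => /predU1P[->|/ih h].
  by rewrite le_max lexx orbT.
by rewrite le_max h.
Qed.

Lemma partial_norm_le K w : partial_norm K w <= `|xi w|.
Proof.
by have [_ xle _] := nx; elim: K => //= K ih; rewrite ge_max ih xle.
Qed.

Lemma partial_norm_attained K w : (0 < K)%N ->
  exists2 k, (k < K)%N & partial_norm K w = `|x k (xi w)|.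
Proof.
elim: K => // -[_ _|K /(_ isT)[k kK e] _]; first by exists 0%N => //; apply/max_idPr.
rewrite -[partial_norm K.+2 w]/(Num.max (partial_norm K.+1 w) `|x K.+1 (xi w)|).
have [h|h] := leP (partial_norm K.+1 w) `|x K.+1 (xi w)|; first by exists K.+1.
by exists k => //; exact: ltnW.
Qed.

Lemma measurable_partial_norm K : measurable_fun setT (partial_norm K).
Proof.
elim: K => [|K ih] //=; apply: measurable_maxr => //.
by apply: measurableT_comp => //; exact: measurable_coord.
Qed.

Lemma cvg_partial_norm w : partial_norm n w @[n --> \oo] --> `|xi w|.
Proof.
have [_ xle xsup] := nx.
apply/cvgrPdist_le => e e0.
have hs : has_sup (range (fun k => `|x k (xi w)|)).
  split; first by exists `|x 0%N (xi w)|; exists 0%N.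
  by exists `|xi w| => _ [k _ <-]; exact: xle.
have [_ [k _ <-] hk] := sup_adherent e0 hs.
near=> n; rewrite ger0_norm ?subr_ge0 ?partial_norm_le//.
have kn : (k < n)%N by near: n; exact: nbhs_infty_gt.
have := le_partial_norm n w k kn; rewrite -xsup in hk; lra.
Unshelve. all: by end_near. Qed.

Lemma measurable_norm_vector : measurable_fun setT (fun w => `|xi w|).
Proof.
apply: (measurable_fun_cvg measurable_partial_norm) => w _.
exact: cvg_partial_norm.
Qed.

(** Markov's inequality for the norm at level 2 M, inherited by every f below the norm; it supplies
    the hypothesis [fmed]. *)
Lemma markov_half (M : R) (f : T -> R) : 0 < M -> measurable_fun setT f ->
  (forall w, 0 <= f w <= `|xi w|) -> (\int[P]_w (`|xi w|)%:E <= M%:E)%E ->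
  2^-1 <= Ex P (fun w => step (f w) (2 * M)).
Proof.
move=> M0 mf fxi hM.
have bs : bounded_measurable (fun w => step (f w) (2 * M)).
  have -> : (fun w => step (f w) (2 * M)) = (fun w => step (- (2 * M)) (- f w)).
    by apply/funext => w; rewrite /step lerN2.
  by apply: bm_step; exact: measurableT_comp.
have b1 := bmB _ _ (bm_cst 1) bs.
suff : Ex P (fun w => 1 - step (f w) (2 * M)) <= 2^-1.
  by rewrite (ExB P _ _ (bm_cst 1) bs) Ex_cst; lra.
rewrite -lee_fin (EFin_Ex P _ b1).
have M2 : 0 < 2 * M by rewrite mulr_gt0.
apply: (@le_trans _ _ (\int[P]_w ((2 * M)^-1%:E * (`|xi w|)%:E))%E).
  apply: ge0_le_integral => //.
  - by move=> w _; rewrite lee_fin subr_ge0 /step lern1; case: (_ <= _).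
  - by apply/measurable_EFinP; case: b1.
  - by apply: emeasurable_funM => //; apply/measurable_EFinP; exact: measurable_norm_vector.
  - move=> w _; rewrite -EFinM lee_fin [leRHS]mulrC; have /andP[f0 fx] := fxi w.
    rewrite /step; case: (leP (f w) (2 * M)) => h /=.
      by rewrite subrr mulr_ge0// invr_ge0 ltW.
    by rewrite subr0 ler_pdivlMr// mul1r (le_trans (ltW h)).
rewrite ge0_integralZl_EFin//; last 2 first.
- by apply/measurable_EFinP; exact: measurable_norm_vector.
- by rewrite invr_ge0 ltW.
apply: (@le_trans _ _ ((2 * M)^-1%:E * M%:E)%E).
  by rewrite lee_wpmul2l// lee_fin invr_ge0 ltW.
by rewrite -EFinM lee_fin invfM mulfVK ?lt0r_neq0.
Qed.

(** By Markov |x_k(xi)| <= 2 M with probability at least 1 / 2, while the small ball estimate caps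
    it by 2 M / s. This makes the supremum defining the weak variance a genuine one. *)
Lemma std_coord_le (M : R) k : 0 < M -> (\int[P]_w (`|xi w|)%:E <= M%:E)%E ->
  std P (fun w => x k (xi w)) <= 4 * M.
Proof.
move=> M0 hM; set s := std _ _.
have := std_ge0 P (fun w => x k (xi w)); rewrite -/s le_eqVlt => /predU1P[<-|s0].
  by rewrite mulr_ge0// ltW.
have [_ xle _] := nx.
have M2 : 0 <= 2 * M by rewrite mulr_ge0// ltW.
have mc : measurable_fun setT (fun w => `|x k (xi w)|).
  by apply: measurableT_comp => //; exact: measurable_coord.
have h1 := markov_half M (fun w => `|x k (xi w)|) M0 mc _ hM.
have {}h1 : 2^-1 <= Ex P (fun w => step `|x k (xi w)| (2 * M)).
  by apply: h1 => w; rewrite normr_ge0 xle.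
have h2 := is_gauss_small_ball P _ _ (coord_gauss k) (2 * M) s0 M2.
have mA : measurable ((fun w => x k (xi w)) @^-1` symm_itv (2 * M)).
  rewrite -[X in measurable X]setTI; apply: measurable_coord => //.
  exact: measurable_symm_itv.
rewrite -(Ex_indic P _ mA) lee_fin -/s in h2.
have : 2^-1 <= 2 * M / s.
  apply: (le_trans h1); apply: le_trans h2; rewrite le_eqVlt; apply/orP; left.
  apply/eqP; congr Ex; apply/funext => w; rewrite /step indicE.
  by congr (nat_of_bool _)%:R; apply/idP/idP; rewrite inE.
by rewrite ler_pdivlMr//; lra.
Qed.

Lemma norm_vector_excess (M S D : R) : 0 < M -> 0 < D ->
  (\int[P]_w (`|xi w|)%:E <= M%:E)%E ->
  (forall k, std P (fun w => x k (xi w)) <= S) ->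
  (\int[P]_w (Num.max (`|xi w| - (4 * M + 4 * D)) 0)%:E <=
     (8 * D * Theta (S / D))%:E)%E.
Proof.
move=> M0 D0 hM hS; set c := 4 * M + 4 * D.
have S0 : 0 <= S by rewrite (le_trans _ (hS 0%N))// std_ge0.
(* The number of coordinates and the truncation level grow together; [n.+1] because the
   concentration estimate needs a nonempty family. *)
pose f_ n w := trunc_excess c n%:R (partial_norm n.+1 w).
have bf n : bounded_measurable (f_ n).
  by apply: bm_trunc_excess => //; exact: measurable_partial_norm.
have f0 n w : 0 <= f_ n w by exact: trunc_excess_ge0.
apply: (fatou_le P f_) => //.
- by move=> n; case: (bf n).
- move=> w.
  have c1 : Num.max (partial_norm n.+1 w - c) 0 @[n --> \oo] --> Num.max (`|xi w| - c) 0.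
    have := cvg_partial_norm w; rewrite -cvg_shiftS => h.
    apply/cvgrPdist_le => e e0; move/cvgrPdist_le : h => /(_ e e0) h.
    near=> n.
    have : `| `|xi w| - partial_norm n.+1 w| <= e by near: n.
    have := partial_norm_le n.+1 w.
    move: (partial_norm n.+1 w) `|xi w| => u v uv.
    rewrite ger0_norm ?subr_ge0// => he.
    rewrite ger0_norm ?subr_ge0; last by rewrite ge_max !le_max lerD2r uv lexx orbT.
    rewrite lerBlDr ge_max; apply/andP; split.
      have : u - c <= Num.max (u - c) 0 by rewrite le_max lexx.
      by lra.
    have : 0 <= Num.max (u - c) 0 by rewrite le_max lexx orbT.
    by lra.
  apply: cvg_trans c1; apply: near_eq_cvg; near=> n.
  rewrite /f_ /trunc_excess; apply/esym/min_idPl.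
  have nw : `|xi w| <= n%:R by near: n; exact: nbhs_infty_ger.
  rewrite ge_max ler0n andbT (le_trans _ nw)// (le_trans _ (partial_norm_le n.+1 w))//.
  by rewrite gerBl addr_ge0// mulr_ge0// ltW.
move=> n; rewrite -(EFin_Ex P _ (bf n)) lee_fin.
have D2 : 0 < 2 * D by rewrite mulr_gt0.
(* Indices 2 k and 2 k + 1 carry x_k and - x_k, so the maximum of this signed family is the maximum
   of the absolute values. *)
have h := gaussian_max_excess P coordinate_span coordinate_span_linear
  coordinate_span_gauss (fun i w => (-1) ^+ i * x i./2 (xi w)) (n.+1.*2)
  (fun i => coordinate_span_coord _ _) isT (partial_norm n.+1) M S (2 * D) n%:R
  (measurable_partial_norm _) _ _ _ _ D2 (ler0n _ _).
have cE : 4 * M + 2 * (2 * D) = c by rewrite /c; ring.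
rewrite cE in h; apply: (le_trans (h _ _ _ _)) => {h}.
- move=> w i ilt; apply: (@le_trans _ _ `|x i./2 (xi w)|); last first.
    by apply: le_partial_norm; rewrite ltn_half_double.
  by rewrite (le_trans (ler_norm _))// normrM normrX normrN1 expr1n mul1r.
- move=> w; have [k kn ->] := partial_norm_attained n.+1 w isT.
  have [x0|x0] := leP 0 (x k (xi w)).
    exists k.*2; first by rewrite ltn_double.
    by rewrite doubleK -signr_odd odd_double expr0 mul1r ger0_norm.
  exists k.*2.+1; first by rewrite ltn_Sdouble.
  rewrite -[_.+1./2]/(uphalf k.*2) uphalf_double -signr_odd/= odd_double/= expr1 mulN1r.
  by rewrite ltr0_norm.
- apply: markov_half => //; first exact: measurable_partial_norm.
  by move=> w; rewrite partial_norm_ge0 partial_norm_le.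
- move=> i _; have Hc : coordinate_span (fun w => x i./2 (xi w)) by exact: cspan.
  rewrite (stdZ P coordinate_span coordinate_span_linear coordinate_span_gauss _ _ Hc).
  by rewrite normrX normrN1 expr1n mul1r.
have sqrt2 : Num.sqrt 2 <= 2 :> R.
  by rewrite -[leRHS](@ger0_norm _ 2)// -sqrtr_sqr ler_sqrt//; lra.
have le1 : Theta (Num.sqrt 2 * S / (2 * D)) <= Theta (S / D).
  apply: le_Theta; first by rewrite divr_ge0 ?mulr_ge0 ?sqrtr_ge0 ?(ltW D0).
  rewrite ler_pdivrMr// (_ : S / D * (2 * D) = 2 * S); last by field; rewrite lt0r_neq0.
  by rewrite ler_wpM2r.
by rewrite (_ : 4 * _ = 8 * D * Theta (Num.sqrt 2 * S / (2 * D))) ?ler_pM2l ?mulr_gt0//; ring.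
Unshelve. all: by end_near. Qed.

End gaussian_vector.

(** * Upper and lower bounds *)

Section theta_norms.
Context {R : realType}.
Variable a : nat -> R.
Hypothesis a0 : forall n, 0 <= a n.

Lemma rhoTheta_ge0 : (0 <= rhoTheta a)%E.
Proof. by apply: le_ereal_inf_tmp => _ [d [d0 _] <-]; rewrite lee_fin ltW. Qed.

Lemma normTheta_ge0 : (0 <= normTheta a)%E.
Proof.
apply: le_ereal_inf_tmp => _ [d d0 <-]; rewrite mule_ge0 ?lee_fin ?invr_ge0 ?(ltW d0)//.
by rewrite adde_ge0// nneseries_ge0// => n _ _; rewrite lee_fin Theta_ge0.
Qed.

(** If s is the sum at d, then (1 + s) / d is admissible for [rhoTheta]: dividing the arguments by 1
    + s brings the sum down to at most s / (1 + s)^2 <= 1. *)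
Lemma rhoTheta_le_normTheta : (rhoTheta a <= normTheta a)%E.
Proof.
apply: le_ereal_inf_tmp => _ [d d0 <-].
have := @nneseries_ge0 R (fun n => (Theta (d * a n))%:E) xpredT 0
  (fun n _ _ => Theta_ge0 _).
case E : (\sum_(n <oo) (Theta (d * a n))%:E)%E => [s| |//] s0; last first.
  by rewrite addey// mulry gtr0_sg ?invr_gt0// mul1e leey.
rewrite lee_fin in s0.
have s1 : 0 < 1 + s by lra.
apply: ereal_inf_lbound; exists ((1 + s) / d); last by rewrite -EFinD -EFinM mulrC.
split; first by rewrite divr_gt0.
apply: (@le_trans _ _ (\sum_(n <oo) ((1 + s) ^- 2)%:E * (Theta (d * a n))%:E)%E).
  apply: lee_nneseries => [n _ _|n _]; first by rewrite lee_fin Theta_ge0.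
  rewrite -EFinM lee_fin [leRHS]mulrC.
  have -> : a n / ((1 + s) / d) = d * a n / (1 + s).
    by field; rewrite !lt0r_neq0.
  by apply: Theta_div_le; [rewrite mulr_ge0// ltW|lra].
rewrite nneseriesZl; last by move=> n _; rewrite lee_fin Theta_ge0.
rewrite E -EFinM lee_fin mulrC ler_pdivrMr ?exprn_gt0//; nra.
Qed.

(** An admissible d for [rhoTheta], inverted, gives the value d (1 + sum) <= 2 d. *)
Lemma normTheta_le_rhoTheta : (normTheta a <= 2%:E * rhoTheta a)%E.
Proof.
rewrite -lee_pdivrMl//; apply: le_ereal_inf_tmp => _ [d [d0 hd] <-].
rewrite lee_pdivrMl//.
apply: (@le_trans _ _ ((d^-1)^-1%:E * (1 + \sum_(n <oo) (Theta (d^-1 * a n))%:E))%E).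
  by apply: ereal_inf_lbound; exists d^-1 => //=; rewrite invr_gt0.
rewrite invrK muleC lee_wpmul2r ?lee_fin ?(ltW d0)//.
rewrite (_ : 2%:E = 1 + 1)%E; last by rewrite -EFinD.
rewrite leeD2l//; apply: le_trans hd.
by apply: lee_nneseries => [n _ _|n _]; rewrite lee_fin ?Theta_ge0// mulrC.
Qed.

End theta_norms.

(** Inductive step: (1 - u)(1 + S + u) <= 1 + S. A lower bound on the product thus becomes an upper
    bound on the sum, without logarithms. *)
Lemma prod_sum_bound {R : realType} (N : nat) (p : nat -> R) :
  (forall i, 0 <= p i <= 1) ->
  (\prod_(i < N) (1 - p i)) * (1 + \sum_(i < N) p i) <= 1.
Proof.
move=> hp; elim: N => [|N ih]; first by rewrite !big_ord0; lra.
rewrite !big_ord_recr/=.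
have A0 : 0 <= \prod_(i < N) (1 - p i).
  by apply: prodr_ge0 => i _; have := hp i; lra.
have S0 : 0 <= \sum_(i < N) p i by apply: sumr_ge0 => i _; have := hp i; lra.
have := hp N; move: (p N) (\prod_(i < N) _) (\sum_(i < N) _) ih A0 S0 => u A S ih A0 S0.
move=> /andP[u0 u1]; apply: le_trans ih.
rewrite -mulrA ler_wpM2l//; nra.
Qed.

(** * Sequences of Gaussian vectors *)

Section sequence_of_gaussians.
Context {R : realType} {d : measure_display} {T : measurableType d}.
Variables (P : probability T R) (X : normedModType R) (x : nat -> X -> R)
  (xi : nat -> T -> X).
Hypotheses (nx : norming_seq x) (gxi : forall n, centered_gaussian P x (xi n)).

Definition sup_norm w : \bar R := ereal_sup (range (fun n => (`|xi n w|)%:E)).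

Definition weak_std n : R := sup (range (fun k => std P (fun w => x k (xi n w)))).

Let mnorm n : measurable_fun setT (fun w => (`|xi n w|)%:E).
Proof. by apply/measurable_EFinP; exact: (measurable_norm_vector P X x). Qed.

Lemma measurable_sup_norm : measurable_fun setT sup_norm.
Proof.
have := @measurable_fun_esups _ _ _ setT (fun n w => (`|xi n w|)%:E) mnorm 0%N.
congr (measurable_fun _ _); apply/funext => w; rewrite /esups /sup_norm /=.
by congr ereal_sup; apply/seteqP; split => _ [n _ <-]; exists n.
Qed.

Lemma sup_norm_ub n w : ((`|xi n w|)%:E <= sup_norm w)%E.
Proof. by apply: ereal_sup_ubound; exists n. Qed.

Lemma sup_norm_ge0 w : (0 <= sup_norm w)%E.
Proof. by apply: le_trans (sup_norm_ub 0 w); rewrite lee_fin. Qed.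

Lemma weak_std_ge0 n : 0 <= weak_std n.
Proof.
have [hA|hA] := pselect (has_sup (range (fun k => std P (fun w => x k (xi n w)))));
  last by rewrite /weak_std sup_out.
apply: (@le_trans _ _ (std P (fun w => x 0%N (xi n w)))); first exact: std_ge0.
by apply: sup_ubound; [case: hA|exists 0%N].
Qed.

Section mean_bound.
Variable M : R.
Hypotheses (M0 : 0 < M) (hM : forall n, (\int[P]_w (`|xi n w|)%:E <= M%:E)%E).

Lemma has_sup_std n : has_sup (range (fun k => std P (fun w => x k (xi n w)))).
Proof.
split; first by exists (std P (fun w => x 0%N (xi n w))); exists 0%N.
by exists (4 * M) => _ [k _ <-]; exact: (std_coord_le P X x (xi n) nx (gxi n)).
Qed.

Lemma std_le_weak_std n k : std P (fun w => x k (xi n w)) <= weak_std n.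
Proof. by apply: sup_ubound; [case: (has_sup_std n)|exists k]. Qed.

(** Pointwise the supremum is at most c plus the sum over n of the excesses of |xi_n| over the
    common level c; these sum in mean to at most 8 D. *)
Lemma integral_sup_norm_le D : 0 < D ->
  (\sum_(n <oo) (Theta (weak_std n / D))%:E <= 1)%E ->
  (\int[P]_w sup_norm w <= (4 * M + 12 * D)%:E)%E.
Proof.
move=> D0 hD; set c := 4 * M + 4 * D.
have c0 : 0 <= c by rewrite addr_ge0// mulr_ge0// ltW.
pose e n w : \bar R := (Num.max (`|xi n w| - c) 0)%:E.
have e0 n w : (0 <= e n w)%E by rewrite lee_fin le_max lexx orbT.
have me n : measurable_fun setT (e n).
  apply/measurable_EFinP; apply: measurable_maxr => //; apply: measurable_funB => //.
  exact: (measurable_norm_vector P X x).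
have ms : measurable_fun setT (fun w => \sum_(n <oo) e n w)%E.
  by apply: ge0_emeasurable_sum => // n w _ _; exact: e0.
apply: (@le_trans _ _ (\int[P]_w (c%:E + \sum_(n <oo) e n w))%E).
  apply: ge0_le_integral => //.
  - by move=> w _; exact: sup_norm_ge0.
  - exact: measurable_sup_norm.
  - exact: emeasurable_funD.
  move=> w _; apply: ge_ereal_sup => _ [n _ <-].
  apply: (@le_trans _ _ (c%:E + e n w)%E).
    rewrite -EFinD lee_fin -lerBlDl le_max lexx//.
  rewrite leeD2l//.
  apply: le_trans (@nneseries_lim_ge R (e ^~ w) xpredT 0 n.+1 (fun n _ _ => e0 n w)).
  by rewrite big_nat_recr//= leeDr// sume_ge0.
rewrite ge0_integralD//; last first.
  by move=> w _; exact: nneseries_ge0.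
rewrite integral_cst//= probability_setT mule1 integral_nneseries//.
apply: (@le_trans _ _ (c%:E + \sum_(n <oo) ((8 * D)%:E * (Theta (weak_std n / D))%:E))%E).
  rewrite leeD2l//; apply: lee_nneseries => [n _ _|n _]; first exact: integral_ge0.
  rewrite -EFinM; apply: (norm_vector_excess P X x (xi n) nx (gxi n)) => // k.
  exact: std_le_weak_std.
rewrite nneseriesZl; last by move=> n _; rewrite lee_fin Theta_ge0.
apply: (@le_trans _ _ (c%:E + (8 * D)%:E * 1)%E).
  by rewrite leeD2l// lee_wpmul2l// lee_fin mulr_ge0// ltW.
by rewrite mule1 -EFinD lee_fin /c; lra.
Qed.

End mean_bound.

(** Here p is P(|g| > 4 t) for g of standard deviation s, and y = 4 t / s. The small ball bound
    forces y >= 2 / 3, so (3 y)^-2 <= 1 / 4, and exp(- 9 y^2 / 2) <= exp(- y^2) <= 12 p. *)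
Lemma Theta_tail_le (s t p : R) : 0 <= s -> 0 < t -> p <= 3^-1 ->
  (0 < s -> 1 - p <= 4 * t / s) -> (0 < s -> expR (- (4 * t / s) ^+ 2) / 12 <= p) ->
  0 <= p -> Theta (s / (12 * t)) <= 3 * p.
Proof.
move=> + t0 p3 h1 h2 p0; rewrite le_eqVlt => /predU1P[<-|s0].
  by rewrite mul0r Theta0 mulr_ge0.
have {}h1 := h1 s0; have {}h2 := h2 s0.
set y := 4 * t / s in h1 h2; have y0 : 0 < y by rewrite divr_gt0// mulr_gt0.
have -> : s / (12 * t) = (3 * y)^-1.
  by rewrite /y; field; rewrite !lt0r_neq0.
clearbody y; rewrite ThetaE ?invr_neq0 ?mulf_neq0 ?lt0r_neq0//.
have y2 : 2 / 3 <= y by lra.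
apply: (@le_trans _ _ (4^-1 * expR (- y ^+ 2))); last by lra.
apply: ler_pM; rewrite ?sqr_ge0 ?expR_ge0//.
  have y3 : 2 <= 3 * y by lra.
  rewrite exprVn lef_pV2 ?posrE ?exprn_gt0 ?mulr_gt0//.
  by have : 0 <= (3 * y - 2) * (3 * y + 2) by [rewrite mulr_ge0//; lra]; nra.
rewrite ler_expR lerN2.
have -> : ((3 * y)^-1 ^+ 2 *+ 2)^-1 = 9 / 2 * y ^+ 2.
  by field; rewrite lt0r_neq0.
by have := sqr_ge0 y; lra.
Qed.

Hypothesis ixi : independent P x xi.

Lemma rhoTheta_weak_std_le (t : R) : 0 < t ->
  (\int[P]_w sup_norm w <= t%:E)%E -> (rhoTheta weak_std <= (24 * t)%:E)%E.
Proof.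
move=> t0 ht; have [_ xle _] := nx.
have hM n : (\int[P]_w (`|xi n w|)%:E <= t%:E)%E.
  apply: le_trans ht; apply: ge0_le_integral => //.
  - exact: measurable_sup_norm.
  - by move=> w _; exact: sup_norm_ub.
(* The supremum need not be attained, so a factor 2 is conceded; if it vanishes, any coordinate will
   do. *)
have /choice[k hk] : forall n, exists k, weak_std n <= 2 * std P (fun w => x k (xi n w)).
  move=> n; have := weak_std_ge0 n; rewrite le_eqVlt => /predU1P[<-|s0].
    by exists 0%N; rewrite mulr_ge0// std_ge0.
  have s2 : 0 < weak_std n / 2 by rewrite divr_gt0.
  have [_ [k _ <-] h] := sup_adherent s2 (has_sup_std t t0 hM n).
  by exists k; rewrite -/(weak_std n) in h; lra.
pose g n w := x (k n) (xi n w); pose s n := std P (g n).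
have gg n : is_gauss P (g n) (s n) by exact: (coord_gauss P X x (xi n) (gxi n)).
have mg n : measurable_fun setT (g n) by case: (gg n).
pose A n := g n @^-1` symm_itv (4 * t).
have mA n : measurable (A n).
  by rewrite -[X in measurable X]setTI; apply: mg => //; exact: measurable_symm_itv.
pose p n := 1 - Ex P (\1_(A n)).
have E01 (B : set T) : measurable B -> 0 <= Ex P (\1_B) <= 1.
  by move=> mB; rewrite -!lee_fin (Ex_indic P _ mB) measure_ge0 probability_le1.
have p01 n : 0 <= p n <= 1 by have := E01 _ (mA n); rewrite /p; lra.
have t4 : 0 <= 4 * t by rewrite mulr_ge0// ltW.
(* By independence the product is the probability that no |g_i| exceeds 4 t; otherwise the supremum
   of the norms exceeds 4 t, which by Markov has probability at most 1 / 4. *)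
have prodP N : 3 / 4 <= \prod_(i < N) (1 - p i).
  pose B := \big[setI/setT]_(i <- iota 0 N) A i.
  have mB : measurable B by apply: bigsetI_measurable => i _; exact: mA.
  have PB : Ex P (\1_B) = \prod_(i < N) (1 - p i).
    apply: EFin_inj; rewrite (Ex_indic P _ mB) /B ixi ?iota_uniq//; last first.
      move=> i _; apply: sub_sigma_algebra; exists (k i), (symm_itv (4 * t)).
      by split => //; exact: measurable_symm_itv.
    rewrite -(big_mkord xpredT (fun i => 1 - p i)) /index_iota subn0 -prodEFin.
    by apply: eq_bigr => i _; rewrite /p subKr Ex_indic.
  rewrite -PB.
  have bB : bounded_measurable (\1_B : T -> R) by exact: bm_indic.
  have b1 := bmB _ _ (bm_cst 1) bB.
  suff : Ex P (fun w => 1 - \1_B w) <= 4^-1.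
    by rewrite (ExB P _ _ (bm_cst 1) bB) Ex_cst; lra.
  rewrite -lee_fin (EFin_Ex P _ b1).
  have t4' : 0 < 4 * t by rewrite mulr_gt0.
  apply: (@le_trans _ _ (\int[P]_w ((4 * t)^-1%:E * sup_norm w))%E).
    apply: ge0_le_integral => //.
    - by apply/measurable_EFinP; case: b1.
    - by apply: emeasurable_funM => //; exact: measurable_sup_norm.
    move=> w _; rewrite indicE; have [wB|wB] := boolP (w \in B).
      by rewrite subrr mule_ge0 ?sup_norm_ge0// lee_fin invr_ge0.
    rewrite subr0 lee_pdivlMl// mule1.
    have [i _ wi] : exists2 i, i \in iota 0 N & ~ A i w.
      apply: contrapT => h; move/negP : wB; apply; rewrite inE /B.
      rewrite -bigcap_seq => i /= iN; apply: contrapT => wi; apply: h.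
      by exists i.
    apply: le_trans (sup_norm_ub i w); rewrite lee_fin.
    apply: le_trans (xle (k i) (xi i w)); apply: ltW; rewrite ltNge; exact/negP.
  rewrite ge0_integralZl_EFin//; last 3 first.
  - by move=> w _; exact: sup_norm_ge0.
  - exact: measurable_sup_norm.
  - by rewrite invr_ge0.
  apply: (@le_trans _ _ ((4 * t)^-1%:E * t%:E)%E).
    by rewrite lee_wpmul2l// lee_fin invr_ge0.
  by rewrite -EFinM lee_fin invfM mulfVK ?lt0r_neq0.
have sump N : \sum_(i < N) p i <= 3^-1.
  have := prod_sum_bound N p p01; have := prodP N.
  have S0 : 0 <= \sum_(i < N) p i by apply: sumr_ge0 => i _; have /andP[] := p01 i.
  move: (\prod_(i < N) _) (\sum_(i < N) _) S0 => A' S' S0; nra.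
have th n : Theta (weak_std n / (24 * t)) <= 3 * p n.
  apply: (@le_trans _ _ (Theta (s n / (12 * t)))).
    apply: le_Theta; first by rewrite divr_ge0 ?weak_std_ge0// mulr_ge0// ltW.
    rewrite ler_pdivrMr ?mulr_gt0// (_ : s n / (12 * t) * (24 * t) = 2 * s n) ?hk//.
    by field; rewrite lt0r_neq0.
  have /andP[pn0 pn1] := p01 n.
  apply: Theta_tail_le => //; first exact: std_ge0.
  - have := sump n.+1; rewrite big_ord_recr/=.
    have : 0 <= \sum_(i < n) p i by apply: sumr_ge0 => i _; have /andP[] := p01 i.
    by move: (\sum_(i < n) _) => S'; lra.
  - move=> s0; rewrite /p subKr -lee_fin (Ex_indic P _ (mA n)).
    exact: (is_gauss_small_ball P _ _ (gg n)).
  - move=> s0; rewrite -lee_fin.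
    apply: (le_trans (is_gauss_tail_lower P _ _ (gg n) (4 * t) s0 t4)).
    rewrite -[X in P X]/(~` A n) probability_setC// /p EFinB (Ex_indic P _ (mA n)).
    by rewrite lexx.
apply: ereal_inf_lbound; exists (24 * t) => //; split; first by rewrite mulr_gt0.
apply: lime_le; first by apply: is_cvg_nneseries => n _ _; rewrite lee_fin Theta_ge0.
apply: nearW => N; rewrite big_mkord sumEFin lee_fin.
apply: (@le_trans _ _ (\sum_(i < N) 3 * p i)); first by apply: ler_sum => i _; exact: th.
by rewrite -mulr_sumr; have := sump N; move: (\sum_(i < N) _) => S'; lra.
Qed.

End sequence_of_gaussians.

(** * Sums of independent Gaussian variables *)

(** The addition formula for independent summands, with sines encoded as cosines of phase - pi / 2;
    it is the Gaussian counterpart of adding one more summand. *)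
Lemma gaussE_convolution_split {R : realType} (s1 s2 t c : R) : 0 <= s1 -> 0 <= s2 ->
  gaussE (Num.sqrt (s1 ^+ 2 + s2 ^+ 2)) (fun u => cos (t * u + c)) =
  gaussE s1 (fun y => cos (t * y)) * gaussE s2 (fun u => cos (t * u + c)) -
  gaussE s1 (fun y => sin (t * y)) * gaussE s2 (fun u => cos (t * u + (c - pi / 2))).
Proof.
move=> s10 s20.
have b e : bounded_measurable (fun u : R => cos (t * u + e)).
  by apply: bm_cos; apply: measurable_funD => //; apply: measurable_funM.
have bc : bounded_measurable (fun y : R => cos (t * y)).
  by apply: bm_cos; apply: measurable_funM.
have bs : bounded_measurable (fun y : R => sin (t * y)).
  by apply: bm_sin; apply: measurable_funM.
have [p pE] : {p | p = gaussE s2 (fun u => cos (t * u + c))} by eexists.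
have [q qE] : {q | q = gaussE s2 (fun u => cos (t * u + (c - pi / 2)))} by eexists.
have e y : gaussE s2 (fun u => cos (t * u + (t * y + c))) =
    p * cos (t * y) + (- q) * sin (t * y).
  have -> : (fun u => cos (t * u + (t * y + c))) = (fun u =>
      cos (t * y) * cos (t * u + c) + (- sin (t * y)) * cos (t * u + (c - pi / 2))).
    apply/funext => u; rewrite [t * u + (c - _)]addrA cosBpihalf.
    have -> : t * u + (t * y + c) = t * y + (t * u + c) by ring.
    by rewrite [LHS]cosD; ring.
  by rewrite (gaussE_lin s2 _ _ _ _ (b _) (b _)) -pE -qE; ring.
rewrite -pE -qE; have := gaussE_convolution s1 s2 t c s10 s20.
rewrite (funext e) (gaussE_lin s1 p (- q) _ _ bc bs) => <-.
by ring.
Qed.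

Section independent_sums.
Context {R : realType} {d : measure_display} {T : measurableType d}.
Variables (P : probability T R) (X : normedModType R) (x : nat -> X -> R)
  (xi : nat -> T -> X).
Hypotheses (gxi : forall n, centered_gaussian P x (xi n)) (ixi : independent P x xi).
Variables (N : nat) (a : nat -> nat -> R).

Let Y i w : R := \sum_(k < N) a i k * x k (xi i w).

Let gens i : set (set T) := [set A | exists k (B : set R), measurable B /\
                 A = (fun w => x k (xi i w)) @^-1` B].

Let mcoord i k : measurable_fun setT (fun w => x k (xi i w)).
Proof. exact: (measurable_coord P). Qed.

Let gen_sigma_measurable i A : gen_sigma x (xi i) A -> measurable A.
Proof.
apply: smallest_sub; first exact: sigma_algebra_measurable.
by move=> _ [k [B [mB ->]]]; rewrite -[X in measurable X]setTI; exact: mcoord.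
Qed.

(** [independent] speaks of the sigma-algebra generated by the coordinates; their finite
    combinations are measurable for it. *)
Let gen_sigma_preimage i (B : set R) : measurable B -> gen_sigma x (xi i) (Y i @^-1` B).
Proof.
move=> mB.
have mY : measurable_fun (setT : set (g_sigma_algebraType (gens i))) (Y i).
  apply: measurable_sum => k; apply: measurable_funM => // _ C mC.
  by rewrite setTI; apply: sub_sigma_algebra; exists k, C.
by have := mY measurableT B mB; rewrite setTI.
Qed.

Let gaussY i : {s | is_gauss P (Y i) s}.
Proof. by apply: cid; apply/centered_gaussian_realP; exact: gxi. Qed.

Let s i := sval (gaussY i).

Let gY i : is_gauss P (Y i) (s i). Proof. exact: (svalP (gaussY i)). Qed.

Let mY i : measurable_fun setT (Y i). Proof. by case: (gY i). Qed.

Let v j := Num.sqrt (\sum_(i < j) s i ^+ 2).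

Let S j w := \sum_(i < j) Y i w.

Let mS j : measurable_fun setT (S j).
Proof. by apply: measurable_sum => i; exact: mY. Qed.

Let mlin (dS : measure_display) (U : measurableType dS) (f : U -> R) t c :
  measurable_fun setT f -> measurable_fun setT (fun w => t * f w + c).
Proof. by move=> mf; apply: measurable_funD => //; apply: measurable_funM. Qed.

Let gaussE_succ j t c : gaussE (v j.+1) (fun u => cos (t * u + c)) =
  gaussE (s j) (fun y => cos (t * y)) * gaussE (v j) (fun u => cos (t * u + c)) -
  gaussE (s j) (fun y => sin (t * y)) * gaussE (v j) (fun u => cos (t * u + (c - pi / 2))).
Proof.
have sj := is_gauss_ge0 _ _ _ (gY j).
have v2 : v j ^+ 2 = \sum_(i < j) s i ^+ 2.
  by rewrite /v sqr_sqrtr// sumr_ge0// => i _; exact: sqr_ge0.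
have -> : v j.+1 = Num.sqrt (s j ^+ 2 + v j ^+ 2).
  by rewrite v2 addrC /v big_ord_recr.
exact: gaussE_convolution_split sj (sqrtr_ge0 _).
Qed.

Let inter (l : seq nat) (A : nat -> set T) := \big[setI/setT]_(i <- l) A i.

Let measurable_inter l A : (forall i, i \in l -> gen_sigma x (xi i) (A i)) ->
  measurable (inter l A).
Proof.
move=> gl; rewrite /inter big_seq; apply: bigsetI_measurable => i il.
exact: gen_sigma_measurable (gl _ il).
Qed.

(** The indicator of events from blocks of index at least j strengthens the induction: when summand
    j is split off, events about it are moved into that indicator. *)
Lemma char_partial_sum j (l : seq nat) (A : nat -> set T) t c :
  uniq l -> (forall i, i \in l -> (j <= i)%N) ->
  (forall i, i \in l -> gen_sigma x (xi i) (A i)) ->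
  Ex P (fun w => \1_(inter l A) w * cos (t * S j w + c)) =
  Ex P (\1_(inter l A)) * gaussE (v j) (fun u => cos (t * u + c)).
Proof.
elim: j l A c => [|j ih] l A c ul jl gl.
  have mI : measurable (inter l A) by exact: measurable_inter gl.
  have bI : bounded_measurable (\1_(inter l A) : T -> R) by exact: bm_indic.
  have -> : v 0 = 0 by rewrite /v big_ord0 sqrtr0.
  rewrite gaussE0 mulr0 add0r mulrC -(ExZ P _ _ bI); congr Ex.
  by apply/funext => w; rewrite /S big_ord0 mulr0 add0r mulrC.
set C := inter l A.
have mC : measurable C by exact: measurable_inter gl.
have bC : bounded_measurable (\1_C : T -> R) by exact: bm_indic.
have jnl : j \notin l by apply/negP => /jl; rewrite ltnn.
(* The induction hypothesis for the list j :: l with event B at j, followed by P(B and C) = P(B)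
   P(C). *)
have step1 B c' : gen_sigma x (xi j) B ->
    Ex P (fun w => \1_B w * \1_C w * cos (t * S j w + c')) =
    Ex P (\1_B) * (Ex P (\1_C) * gaussE (v j) (fun u => cos (t * u + c'))).
  move=> gB; have mB := gen_sigma_measurable _ _ gB.
  pose A' i := if i == j then B else A i.
  have gA' i : i \in j :: l -> gen_sigma x (xi i) (A' i).
    rewrite /A' inE; case: eqP => [->//|_] /=; exact: gl.
  have eC : inter l A' = C.
    rewrite /C /inter; apply: eq_big_seq => i il; rewrite /A'.
    by case: eqP => // ij; rewrite -ij il in jnl.
  have eBC : inter (j :: l) A' = B `&` C.
    by rewrite /inter big_cons -/(inter l A') eC /A' eqxx.
  have uj : uniq (j :: l) by rewrite /= jnl.
  have -> : (fun w => \1_B w * \1_C w * cos (t * S j w + c')) =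
      (fun w => \1_(B `&` C) w * cos (t * S j w + c')).
    by apply/funext => w; rewrite indicI.
  have jjl i : i \in j :: l -> (j <= i)%N.
    by rewrite inE => /predU1P[->//|/jl/ltnW].
  have := ih (j :: l) A' c' uj jjl gA'; rewrite eBC => ->.
  rewrite mulrA; congr (_ * _); apply: EFin_inj.
  rewrite EFinM !Ex_indic//; last exact: measurableI.
  have pl : P C = (\prod_(i <- l) P (A' i))%E.
    rewrite -eC; apply: ixi => // i il; apply: gA'; by rewrite inE il orbT.
  have pjl := ixi (j :: l) A' uj gA'.
  by rewrite -/(inter (j :: l) A') eBC big_cons -pl {1}/A' eqxx in pjl.
have bcos e : bounded_measurable (fun w => cos (t * S j w + e)).
  by apply: bm_cos; exact: mlin.
pose Hc (h : T -> R) := bounded_measurable h /\ forall c',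
  Ex P (fun w => h w * \1_C w * cos (t * S j w + c')) =
  Ex P h * (Ex P (\1_C) * gaussE (v j) (fun u => cos (t * u + c'))).
have Hlin : linear_class Hc.
  move=> p q f g [bf Hf] [bg Hg]; split; first by apply: bmD; exact: bmZ.
  move=> c'; have b1 := bmM _ _ (bmM _ _ bf bC) (bcos c').
  have b2 := bmM _ _ (bmM _ _ bg bC) (bcos c').
  have -> : (fun w => (p * f w + q * g w) * \1_C w * cos (t * S j w + c')) = (fun w =>
    p * (f w * \1_C w * cos (t * S j w + c')) + q * (g w * \1_C w * cos (t * S j w + c'))).
    by apply/funext => w; ring.
  rewrite (ExD P _ _ (bmZ p _ b1) (bmZ q _ b2)) (ExZ P p _ b1) (ExZ P q _ b2) Hf Hg.
  by rewrite (ExD P _ _ (bmZ p _ bf) (bmZ q _ bg)) (ExZ P p _ bf) (ExZ P q _ bg); ring.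
have Hlim : limit_class Hc.
  move=> f_ f M Hf fM cf; split.
    by apply: (bm_lim f_ f M) => // n; case: (Hf n) => -[].
  move=> c'.
  have l1 : Ex P (fun w => f_ n w * \1_C w * cos (t * S j w + c')) @[n --> \oo] -->
      Ex P (fun w => f w * \1_C w * cos (t * S j w + c')).
    apply: (cvg_Ex P _ _ (M * 1 * 1)) => [n|n w|w].
    - by have [bn _] := Hf n; have [] := bmM _ _ (bmM _ _ bn bC) (bcos c').
    - rewrite !normrM ler_pM ?mulr_ge0// ?ler_norml ?cos_geN1 ?cos_le1//.
      rewrite ler_pM// indicE ger0_norm ?ler0n// lern1; by case: (_ \in _).
    - apply: cvgM; last exact: cvg_cst.
      by apply: cvgM; [exact: cf | exact: cvg_cst].
  set k := Ex P (\1_C) * _.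
  have l2 : Ex P (f_ n) * k @[n --> \oo] --> Ex P f * k.
    apply: cvgM; last exact: cvg_cst.
    by apply: (cvg_Ex P _ _ M) => // n; case: (Hf n) => -[].
  have e n : Ex P (fun w => f_ n w * \1_C w * cos (t * S j w + c')) = Ex P (f_ n) * k.
    by case: (Hf n) => _; exact.
  rewrite (funext e) in l1.
  by rewrite -(cvg_lim _ l1)// -(cvg_lim _ l2).
(* Superlevel sets of this cosine are preimages of Borel sets under [Y j], so [step1] applies to
   them and layer cake extends it to the cosine. *)
have Hcos e : Hc (fun w => cos (t * Y j w + e)).
  apply: (class_of_halfline_indic Hc Hlin Hlim _ 1) => [w|u].
    by rewrite ler_norml cos_geN1 cos_le1.
  pose B : set R := (fun y => cos (t * y + e)) @^-1` `[u, +oo[%classic.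
  have mB : measurable B.
    have bb : bounded_measurable (fun y : R => cos (t * y + e)) by apply: bm_cos; apply: mlin.
    by rewrite -[X in measurable X]setTI; case: bb => + _; apply.
  have gB := gen_sigma_preimage j B mB.
  have -> : (fun w => step u (cos (t * Y j w + e))) = \1_(Y j @^-1` B).
    apply/funext => w; rewrite /step indicE; congr (nat_of_bool _)%:R.
    by apply/idP/idP; rewrite inE /B /= in_itv/= andbT.
  split; first by apply: bm_indic; exact: gen_sigma_measurable gB.
  by move=> c'; exact: step1.
have [b0 /(_ c) h0] := Hcos 0.
have [b1 /(_ (c - pi / 2)) h1] := Hcos (- (pi / 2)).
have bM0 := bmM _ _ (bmM _ _ b0 bC) (bcos c).
have bM1 := bmM _ _ (bmM _ _ b1 bC) (bcos (c - pi / 2)).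
have -> : (fun w => \1_C w * cos (t * S j.+1 w + c)) = (fun w =>
   cos (t * Y j w + 0) * \1_C w * cos (t * S j w + c) -
   cos (t * Y j w + - (pi / 2)) * \1_C w * cos (t * S j w + (c - pi / 2))).
  apply/funext => w; rewrite addr0 cosBpihalf [t * S j w + (c - _)]addrA cosBpihalf.
  have -> : t * S j.+1 w + c = t * Y j w + (t * S j w + c).
    by rewrite /S big_ord_recr/=; ring.
  by rewrite cosD; ring.
rewrite (ExB P _ _ bM0 bM1) h0 h1 gaussE_succ.
have bc : bounded_measurable (fun y : R => cos (t * y)).
  by apply: bm_cos; apply: measurable_funM.
have bs : bounded_measurable (fun y : R => sin (t * y)).
  by apply: bm_sin; apply: measurable_funM.
rewrite -(is_gauss_Ex P _ _ (gY j) _ bc) -(is_gauss_Ex P _ _ (gY j) _ bs).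
have -> : (fun w => cos (t * Y j w + 0)) = (fun w => cos (t * Y j w)).
  by apply/funext => w; rewrite addr0.
have -> : (fun w => cos (t * Y j w + - (pi / 2))) = (fun w => sin (t * Y j w)).
  by apply/funext => w; rewrite cosBpihalf.
by ring.
Qed.

Lemma centered_gaussian_independent_sum j :
  centered_gaussian_real P (fun w => \sum_(i < j) \sum_(k < N) a i k * x k (xi i w)).
Proof.
apply/centered_gaussian_realP; exists (v j).
apply: is_gauss_of_char; [exact: (mS j)|exact: sqrtr_ge0|] => t c.
have := char_partial_sum j [::] (fun=> setT) t c isT (fun i (h : i \in [::]) => False_ind _ (notF h))
  (fun i (h : i \in [::]) => False_ind _ (notF h)).
rewrite /inter big_nil indicT Ex_cst mul1r => <-.
by congr Ex; apply/funext => w; rewrite mul1r.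
Qed.

End independent_sums.

(** * The two-sided estimate and almost sure boundedness *)

Theorem theorem3p4 (R : realType) :
  exists C : R, 0 < C /\
  forall (d : measure_display) (T : measurableType d) (P : probability T R)
    (X : completeNormedModType R) (x : nat -> X -> R) (xi : nat -> T -> X),
    norming_seq x ->
    (forall n, centered_gaussian P x (xi n)) ->
    independent P x xi ->
    let Esup : \bar R :=
      (\int[P]_w ereal_sup (range (fun n => (`|xi n w|)%:E)))%E in
    let m : \bar R :=
      ereal_sup (range (fun n => (\int[P]_w (`|xi n w|)%:E)%E)) in
    let sigma : nat -> R := fun n =>
      sup (range (fun k =>
        Num.sqrt (fine (\int[P]_w ((x k (xi n w)) ^+ 2)%:E)%E))) in
    [/\ (C^-1%:E * (m + rhoTheta sigma) <= Esup <= C%:E * (m + rhoTheta sigma))%E,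
        (C^-1%:E * (m + normTheta sigma) <= m + rhoTheta sigma
           <= C%:E * (m + normTheta sigma))%E
      & ((Esup < +oo)%E \/ (m + rhoTheta sigma < +oo)%E
            \/ (m + normTheta sigma < +oo)%E) ->
        (* xi = (xi_n)_n is an l^oo(X)-valued centered Gaussian *)
        ({ae P, forall w, exists M : R, forall n, `|xi n w| <= M} /\
         forall (N : nat) (a : nat -> nat -> R),
           centered_gaussian_real P
             (fun w => \sum_(i < N) \sum_(k < N) a i k * x k (xi i w)))].
Proof.
(* 25 = 1 + 24 from m <= Esup and rho <= 24 Esup; the other comparisons need only 16, 2 and 1. *)
exists 25; split; first by lra.
move=> d T P X x xi nx gxi ixi Esup m sigma.
have EsupE : Esup = (\int[P]_w sup_norm X xi w)%E by [].
have sigmaE : sigma = weak_std P X x xi by [].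
have sigma0 n : 0 <= sigma n by rewrite sigmaE; exact: weak_std_ge0.
have rho0 := rhoTheta_ge0 sigma.
have m0 : (0 <= m)%E.
  by apply: le_trans (ereal_sup_ubound (ex_intro2 _ _ 0%N I erefl)); exact: integral_ge0.
have mE n : (\int[P]_w (`|xi n w|)%:E <= m)%E.
  by apply: ereal_sup_ubound; exists n.
have msup := measurable_sup_norm P X x xi nx gxi.
have mEsup : (m <= Esup)%E.
  apply: ge_ereal_sup => _ [n _ <-]; rewrite EsupE; apply: ge0_le_integral => //.
  - apply/measurable_EFinP; exact: (measurable_norm_vector P X x).
  - by move=> w _; exact: sup_norm_ub.
have Esup0 : (0 <= Esup)%E by exact: le_trans mEsup.
have rho_Esup : (rhoTheta sigma <= 24%:E * Esup)%E.
  case E : Esup Esup0 => [e| |//] e0; last by rewrite mulry gtr0_sg ?mul1e ?leey.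
  (* The expectation may be 0 while the lower bound wants t > 0; t = e + r / 24 costs exactly r. *)
  apply/lee_addgt0Pr => r r0; rewrite lee_fin in e0.
  have t0 : 0 < e + r / 24 by rewrite ltr_wpDl// divr_gt0.
  have h := rhoTheta_weak_std_le P X x xi nx gxi ixi _ t0.
  apply: (le_trans (h _)); last by rewrite -EFinM -EFinD lee_fin; lra.
  by rewrite -EsupE E lee_fin lerDl divr_ge0// ltW.
have Esup_le : (Esup <= 16%:E * (m + rhoTheta sigma))%E.
  case mE' : m m0 => [mr| |//] mr0; last first.
    by rewrite addye ?gt_eqF ?(lt_le_trans _ rho0)// mulry gtr0_sg ?mul1e ?leey.
  rewrite -lee_pdivrMl// -leeBlDl//; apply: le_ereal_inf_tmp => _ [D [D0 hD] <-].
  rewrite leeBlDl// lee_pdivrMl// -EFinD -EFinM.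
  rewrite lee_fin in mr0.
  (* Since m may be 0, M = m + D is used; 4 (m + D) + 12 D = 4 m + 16 D is the origin of 16. *)
  have M0 : 0 < mr + D by rewrite ltr_wpDl.
  have hM n : (\int[P]_w (`|xi n w|)%:E <= (mr + D)%:E)%E.
    by apply: (le_trans (mE n)); rewrite mE' lee_fin lerDl ltW.
  apply: (le_trans (integral_sup_norm_le P X x xi nx gxi _ M0 hM D D0 hD)).
  by rewrite lee_fin; lra.
have norm_rho := normTheta_le_rhoTheta sigma.
have rho_norm := rhoTheta_le_normTheta sigma sigma0.
have norm0 := normTheta_ge0 sigma.
have scale (y : \bar R) (p q : R) : (0 <= y)%E -> p <= q -> (p%:E * y <= q%:E * y)%E.
  by move=> y0 pq; rewrite lee_wpmul2r// lee_fin.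
have mr0 : (0 <= m + rhoTheta sigma)%E by rewrite adde_ge0.
have mn0 : (0 <= m + normTheta sigma)%E by rewrite adde_ge0.
have Pn : (m + normTheta sigma <= 25%:E * (m + rhoTheta sigma))%E.
  apply: (@le_trans _ _ (2%:E * (m + rhoTheta sigma))%E); last by apply: scale => //; lra.
  rewrite ge0_muleDr// leeD// -[X in (X <= _)%E]mul1e; apply: scale => //; lra.
have Pr : (m + rhoTheta sigma <= 25%:E * (m + normTheta sigma))%E.
  apply: (@le_trans _ _ (1%:E * (m + normTheta sigma))%E); last by apply: scale => //; lra.
  by rewrite mul1e leeD.
have Eu : (Esup <= 25%:E * (m + rhoTheta sigma))%E.
  by apply: (le_trans Esup_le); apply: scale => //; lra.
split.
- rewrite Eu andbT lee_pdivrMl//.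
  apply: (@le_trans _ _ (1%:E * Esup + 24%:E * Esup)%E); first by rewrite leeD// mul1e.
  by rewrite -ge0_muleDl// -EFinD; apply: scale => //; lra.
- by rewrite lee_pdivrMl// Pn Pr.
move=> hfin; split; last first.
  by move=> N a; exact: (centered_gaussian_independent_sum P X x xi gxi ixi).
have fin25 (y z : \bar R) : (y <= 25%:E * z)%E -> (0 <= z)%E -> (z < +oo)%E -> (y < +oo)%E.
  by move=> yz z0 zoo; apply: (le_lt_trans yz); rewrite lte_mul_pinfty.
have Efin : (Esup < +oo)%E.
  case: hfin => [//|[h|h]]; first exact: fin25 Eu mr0 h.
  exact: fin25 Eu mr0 (fin25 _ _ Pr mn0 h).
have isup : P.-integrable setT (sup_norm X xi).
  apply/integrableP; split => //.
  under eq_integral do rewrite gee0_abs ?sup_norm_ge0//.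
  by rewrite -EsupE.
(* An integrable supremum is finite almost surely, and its value is the bound on the sequence. *)
have := integrable_ae measurableT isup; apply: filterS => w /(_ I) fw.
exists (fine (sup_norm X xi w)) => n; rewrite -lee_fin fineK//.
exact: sup_norm_ub.
Qed.
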